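(* Let $V$ be a vertex operator algebra. Suppose that Zhu's algebra $A(V)$ is semisimple. Then any admissible $V$-module $M$ is decomposed into a direct sum of generalized eigenspaces for $L(0)$ as $$M=\bigoplus_{i=1}^{s}\Bigl(\bigoplus_{n\in\mathbb{N}}M^{(\lambda_i+n)}\Bigr)$$ for some $\lambda_i\in\mathcal{P}(V)$ $(i=1,2,\dots,s)$. Moreover, for each $\lambda_i$, the subspace $\bigoplus_{n\in\mathbb{N}}M^{(\lambda_i+n)}$ is an admissible $V$-submodule of $M$.
   Context: $\mathbb{N}$ is the set of nonnegative integers. Let $V=(V,Y,\mathbf 1,\omega)$ be a vertex operator algebra over $\mathbb{C}$, $Y(a,z)=\sum_{n\in\mathbb{Z}}a(n)z^{-n-1}$, graded by eigenvalues of $L(0)=\omega(1)$; $\mathrm{wt}(a)$ denotes the $L(0)$-eigenvalue of a homogeneous $a$. A weak $V$-module is a vector space $M$ with a linear map $Y_M:V\to(\mathrm{End}\,M)[[z,z^{-1}]]$, $Y_M(a,z)=\sum_{n\in\mathbb{Z}}a(n)z^{-n-1}$, such that $Y_M(a,z)u\in M((z))$ for $a\in V$, $u\in M$, $Y_M(\mathbf 1,z)=\mathrm{id}_M$, and the Jacobi identity $z_0^{-1}\delta(\frac{z_1-z_2}{z_0})Y_M(a,z_1)Y_M(b,z_2)-z_0^{-1}\delta(\frac{z_2-z_1}{-z_0})Y_M(b,z_2)Y_M(a,z_1)=z_2^{-1}\delta(\frac{z_1-z_0}{z_2})Y_M(Y(a,z_0)b,z_2)$ holds. Write $Y_M(\omega,z)=\sum_nL(n)z^{-n-2}$.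 An admissible $V$-module is a weak $V$-module with an $\mathbb{N}$-grading $M=\bigoplus_{n=0}^\infty M_n$ such that $a(n)M_m\subset M_{\mathrm{wt}(a)+m-n-1}$ for homogeneous $a$ ($M_m=0$ for $m<0$). Its degree operator $d$ acts on $M_n$ by $n$. An admissible submodule is a subspace stable under all $a(n)$ and under $d$. An admissible module is irreducible if it is nonzero and its only admissible submodules are $0$ and itself. Zhu's algebra: for homogeneous $a\in V$ and $b\in V$ put $a\circ b=\mathrm{Res}_z\frac{(1+z)^{\mathrm{wt}(a)}}{z^2}Y(a,z)b$ and $a*b=\mathrm{Res}_z\frac{(1+z)^{\mathrm{wt}(a)}}{z}Y(a,z)b$ (extended linearly in $a$); $O(V)$ is the span of all $a\circ b$ and $A(V)=V/O(V)$, an associative algebra under $*$. For an irreducible admissible $V$-module $M$ there is $\lambda\in\mathbb{C}$ with $M=\bigoplus_{n=0}^\infty M(\lambda+n)$, where $M(\lambda+n)$ is the $L(0)$-eigenspace of eigenvalue $\lambda+n$ and $M(\lambda)\ne0$; $\lambda$ is called the lowest weight of $M$. $\mathcal{P}(V)$ is the set of lowest weights of all irreducible admissible $V$-modules. For a weak $V$-module $M$ and $\lambda\in\mathbb{C}$, $M^{(\lambda)}=\{u\in M\mid (L(0)-\lambda)^ku=0\text{ for some }k\in\mathbb{N}\}$. *)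

(* Defs.v *)
(* The field of complex numbers is R[i] for R : realType. *)
From HB Require Import structures.
From mathcomp Require Import all_boot all_order all_algebra.
From mathcomp Require Import generic_quotient ring_quotient.
From mathcomp Require Import boolp classical_sets functions cardinality fsbigop.
From mathcomp Require Import reals complex.

Set Implicit Arguments.
Unset Strict Implicit.
Unset Printing Implicit Defensive.

Import GRing.Theory.
Local Open Scope classical_set_scope.
Local Open Scope ring_scope.
Local Open Scope quotient_scope.

Section LinearAlgebra.
Context {K : nzRingType} {E : lmodType K}.
Implicit Types (W S : set E).

Definition subspace W : Prop :=
  [/\ W 0, forall u v, W u -> W v -> W (u + v)
    & forall (c : K) u, W u -> W (c *: u)].

Definition lin_span S : set E :=
  [set v | forall W, subspace W -> S `<=` W -> W v].

Definition finite_dim W : Prop :=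
  exists (k : nat) (e : 'I_k -> E),
    forall v, W v -> exists c : 'I_k -> K, v = \sum_(j < k) c j *: e j.

Definition eigenspace_of (T : E -> E) (c : K) : set E :=
  [set u | T u = c *: u].

Section Families.
Context {I : choiceType}.
Implicit Types (F : I -> set E) (f g : I -> E).

Definition decomposes F (u : E) f : Prop :=
  [/\ forall i, F i (f i), finite_set [set i | f i != 0]
    & u = \sum_(i \in [set: I]) f i].

Definition sum_space F : set E := [set u | exists f, decomposes F u f].

Definition independent F : Prop :=
  forall u f g, decomposes F u f -> decomposes F u g -> f = g.

Definition direct_sum F W : Prop := independent F /\ sum_space F = W.

(* The family of components of u; meaningful when direct_sum F setT. *)
Definition components F (u : E) : I -> E :=
  xget (fun=> 0) [set f | decomposes F u f].

End Families.

Lemma lin_span_subspace S : subspace (lin_span S).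
Proof.
split=> [W [] //|u v uS vS W sW SW|c u uS W sW SW].
- by case: (sW) => _ WD _; apply: WD; [exact: uS | exact: vS].
- by case: (sW) => _ _ WZ; apply: WZ; exact: uS.
Qed.

Definition lin_spanb S : {pred E} := fun v => `[< lin_span S v >].

Fact lin_spanb_zmod_closed S : zmod_closed (lin_spanb S).
Proof.
have [h0 hD hZ] := lin_span_subspace S.
split=> [|u v]; first exact/asboolP.
move=> /asboolP uS /asboolP vS; apply/asboolP; rewrite -scaleN1r.
by apply: hD => //; exact: hZ.
Qed.

HB.instance Definition _ S :=
  GRing.isZmodClosed.Build E (lin_spanb S) (lin_spanb_zmod_closed S).

(* The quotient of E by the span of S; the canonical surjection is \pi. *)
Definition quot_span S : Type := Quotient.quot (lin_spanb S : zmodClosed E).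

HB.instance Definition _ S := GRing.Zmodule.on (quot_span S).
HB.instance Definition _ S := Quotient.on (quot_span S).

Section QuotientModule.
Variable S : set E.
Local Notation Q := (quot_span S).
Implicit Types (x y : Q) (c : K).

Definition quot_proj (v : E) : Q := \pi_Q v.

Definition quot_scale c x : Q := quot_proj (c *: repr x).

Lemma quot_projP u v : (quot_proj u = quot_proj v) <-> lin_span S (u - v).
Proof.
split=> [/eqP|uv].
- by rewrite /quot_proj -Quotient.idealrBE => /asboolP.
- by apply/eqP; rewrite /quot_proj -Quotient.idealrBE; apply/asboolP.
Qed.

Lemma quot_projD : {morph quot_proj : u v / u + v}.
Proof. by move=> u v; rewrite /quot_proj; exact: raddfD. Qed.

Lemma quot_reprK x : quot_proj (repr x) = x.
Proof. exact: reprK. Qed.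

Lemma quot_projZ c v : quot_proj (c *: v) = quot_scale c (quot_proj v).
Proof.
apply/quot_projP; rewrite -scalerBr.
have [_ _ hZ] := lin_span_subspace S; apply: hZ.
by apply/quot_projP; rewrite quot_reprK.
Qed.

Fact quot_scaleA c d x : quot_scale c (quot_scale d x) = quot_scale (c * d) x.
Proof. by rewrite -[x]quot_reprK -!quot_projZ scalerA. Qed.

Fact quot_scale1 : left_id 1 quot_scale.
Proof. by move=> x; rewrite -[x]quot_reprK -quot_projZ scale1r. Qed.

Fact quot_scaleDr : right_distributive quot_scale +%R.
Proof.
move=> c x y; rewrite -[x]quot_reprK -[y]quot_reprK -quot_projD -!quot_projZ.
by rewrite -quot_projD scalerDr.
Qed.

Fact quot_scaleDl x : {morph quot_scale^~ x : c d / c + d}.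
Proof.
by move=> c d; rewrite -[x]quot_reprK -!quot_projZ -quot_projD scalerDl.
Qed.

HB.instance Definition _ := GRing.Zmodule_isLmodule.Build K Q
  quot_scaleA quot_scale1 quot_scaleDr quot_scaleDl.

End QuotientModule.

(* Semisimplicity of the algebra with underlying space E and product mul: it is
   the direct sum of minimal left ideals, as a left module over itself. *)
Section SemisimpleAlgebra.
Variable mul : E -> E -> E.

Definition left_ideal W : Prop :=
  subspace W /\ forall x y, W y -> W (mul x y).

Definition minimal_left_ideal W : Prop :=
  [/\ left_ideal W, W <> [set 0]
    & forall W', left_ideal W' -> W' `<=` W -> W' = [set 0] \/ W' = W].

Definition semisimple : Prop :=
  exists (I : choiceType) (F : I -> set E),
    (forall i, minimal_left_ideal (F i)) /\ direct_sum F setT.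

End SemisimpleAlgebra.

End LinearAlgebra.

Section FormalCalculus.
Context {R : realType}.
Local Notation C := R[i].

(* The coefficient of z^i in (1 + z)^m, for m an arbitrary integer. *)
Definition binz (m : int) (i : nat) : C :=
  (\prod_(j < i) (m%:~R - j%:R)) / (i`!)%:R.

(* [Y a n] is the mode a(n), the coefficient of z^(-n-1) in Y(a,z). *)
Definition bilinear_modes (V M : lmodType C) (Y : V -> int -> M -> M) : Prop :=
  (forall n u, linear (fun a => Y a n u)) /\ (forall a n, linear (Y a n)).

Definition truncated (V M : lmodType C) (Y : V -> int -> M -> M) : Prop :=
  forall a u, exists N : int, forall n : int, N <= n -> Y a n u = 0.

(* The Jacobi identity, read off as the equality of the coefficients of
   z0^(-l-1) z1^(-m-1) z2^(-n-1) on both sides, where (x - y)^k is expanded in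
   nonnegative powers of y. The sums have finite support by truncation. *)
Definition jacobi (V M : lmodType C)
    (YV : V -> int -> V -> V) (Y : V -> int -> M -> M) : Prop :=
  forall (a b : V) (u : M) (l m n : int),
    \sum_(i \in [set: nat]) ((-1) ^+ i * binz l i) *:
        Y a (l + m - i%:Z) (Y b (n + i%:Z) u)
    - \sum_(i \in [set: nat]) ((-1) ^ l * (-1) ^+ i * binz l i) *:
        Y b (l + n - i%:Z) (Y a (m + i%:Z) u)
    = \sum_(i \in [set: nat]) binz m i *:
        Y (YV a (l + i%:Z) b) (m + n - i%:Z) u.

Definition vacuum_identity (V M : lmodType C)
    (Y : V -> int -> M -> M) (vac : V) : Prop :=
  forall n u, Y vac n u = if n == -1 then u else 0.

End FormalCalculus.

Record VOA (R : realType) := MkVOA {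
  voa_space :> lmodType R[i];
  voa_Y : voa_space -> int -> voa_space -> voa_space;
  voa_vac : voa_space;
  voa_omega : voa_space;
  voa_charge : R[i];
  voa_bilinear : bilinear_modes voa_Y;
  voa_truncated : truncated voa_Y;
  voa_vacuum : vacuum_identity voa_Y voa_vac;
  voa_creation : forall a,
    voa_Y a (-1) voa_vac = a /\ forall n : nat, voa_Y a n%:Z voa_vac = 0;
  voa_jacobi : jacobi voa_Y voa_Y;
  (* L(n) = omega(n + 1) *)
  voa_virasoro : forall (m n : int) (v : voa_space),
    voa_Y voa_omega (m + 1) (voa_Y voa_omega (n + 1) v)
    - voa_Y voa_omega (n + 1) (voa_Y voa_omega (m + 1) v)
    = (m - n)%:~R *: voa_Y voa_omega (m + n + 1) v
      + (if m + n == 0 then ((m ^+ 3 - m)%:~R / 12%:R * voa_charge) *: v else 0);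
  voa_derivative : forall a (n : int) v,
    voa_Y (voa_Y voa_omega 0 a) n v = - (n%:~R *: voa_Y a (n - 1) v);
  voa_graded : direct_sum
    (fun k : int => eigenspace_of (voa_Y voa_omega 1) k%:~R) setT;
  voa_finite_dim : forall k : int,
    finite_dim (eigenspace_of (voa_Y voa_omega 1) k%:~R);
  voa_bounded_below : exists N : int, forall k : int, k < N ->
    eigenspace_of (voa_Y voa_omega 1) k%:~R = [set 0]
}.

Section VOATheory.
Context {R : realType} (V : VOA R).
Local Notation C := R[i].

Definition wt_space (k : int) : set V :=
  eigenspace_of (voa_Y (voa_omega V) 1) k%:~R.

(* Zhu's products: Res_z (1+z)^(wt a) z^(-2) Y(a,z) b and
   Res_z (1+z)^(wt a) z^(-1) Y(a,z) b, summed over the homogeneous components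
   of a. *)
Definition zhu_circ (a b : V) : V :=
  \sum_(k \in [set: int]) \sum_(i \in [set: nat])
    binz k i *: voa_Y (components wt_space a k) (i%:Z - 2) b.

Definition zhu_star (a b : V) : V :=
  \sum_(k \in [set: int]) \sum_(i \in [set: nat])
    binz k i *: voa_Y (components wt_space a k) (i%:Z - 1) b.

Definition zhu_generators : set V := [set zhu_circ p.1 p.2 | p in [set: V * V]].

(* A(V) = V / O(V), where O(V) = lin_span zhu_generators. *)
Definition zhu_algebra : lmodType C := quot_span zhu_generators.

(* The product of A(V) induced by zhu_star; O(V) is a two-sided ideal for
   zhu_star, hence the choice of representatives is immaterial. *)
Definition zhu_mul (x y : zhu_algebra) : zhu_algebra :=
  quot_proj zhu_generators (zhu_star (repr x) (repr y)).

Record weak_module := MkWeakModule {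
  wmod_space :> lmodType C;
  wmod_Y : V -> int -> wmod_space -> wmod_space;
  wmod_bilinear : bilinear_modes wmod_Y;
  wmod_truncated : truncated wmod_Y;
  wmod_vacuum : vacuum_identity wmod_Y (voa_vac V);
  wmod_jacobi : jacobi (@voa_Y R V) wmod_Y
}.

(* [vir n] is the action of L(n), where Y_M(omega,z) = sum_n L(n) z^(-n-2). *)
Section WeakModule.
Variable M : weak_module.

Definition vir (n : int) : M -> M := @wmod_Y M (voa_omega V) (n + 1).

Definition L0_eigenspace (c : C) : set M := eigenspace_of (vir 0) c.

Definition gen_L0_eigenspace (c : C) : set M :=
  [set u | exists k : nat, iter k (fun v => vir 0 v - c *: v) u = 0].

Definition has_lowest_weight (lambda : C) : Prop :=
  direct_sum (fun n : nat => L0_eigenspace (lambda + n%:R)) setT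
  /\ L0_eigenspace lambda <> [set 0].

End WeakModule.

(* The extension of an N-grading by 0 in negative degrees. *)
Definition int_graded (E : lmodType C) (F : nat -> set E) (j : int) : set E :=
  match j with Posz n => F n | Negz _ => [set 0] end.

Record admissible_module := MkAdmissible {
  amod_weak :> weak_module;
  amod_deg : nat -> set amod_weak;
  amod_deg_subspace : forall n, subspace (amod_deg n);
  amod_deg_direct : direct_sum amod_deg setT;
  amod_deg_shift : forall (k : int) (a : V), wt_space k a ->
    forall (n : int) (m : nat) (u : amod_weak), amod_deg m u ->
      int_graded amod_deg (k + m%:Z - n - 1) (wmod_Y a n u)
}.

Section AdmissibleModule.
Variable M : admissible_module.

Definition degree_op (u : M) : M :=
  \sum_(n \in [set: nat]) n%:R *: components (@amod_deg M) u n.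

Definition admissible_submodule (N : set M) : Prop :=
  [/\ subspace N, forall (a : V) (n : int) u, N u -> N (wmod_Y a n u)
    & forall u, N u -> N (degree_op u)].

Definition irreducible : Prop :=
  [set: M] <> [set 0] /\
  forall N, admissible_submodule N -> N = [set 0] \/ N = setT.

End AdmissibleModule.

(* The set of lowest weights of the irreducible admissible V-modules. *)
Definition lowest_weights : set C :=
  [set lambda | exists M : admissible_module,
     irreducible M /\ has_lowest_weight M lambda].

End VOATheory.

Arguments zhu_mul {R} V x y.
Arguments vir {R V} M n u.
Arguments L0_eigenspace {R V} M c _.
Arguments gen_L0_eigenspace {R V} M c _.
Arguments has_lowest_weight {R V} M lambda.
Arguments admissible_submodule {R V} M N.
Arguments irreducible {R V} M.

(* Main.v *)
Require Import Defs.
From HB Require Import structures.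
From mathcomp Require Import all_boot all_order all_algebra.
From mathcomp Require Import boolp classical_sets functions cardinality fsbigop.
From mathcomp Require Import reals complex.
From mathcomp Require Import ring lra zify.

Set Implicit Arguments.
Unset Strict Implicit.
Unset Printing Implicit Defensive.

Import Order.TTheory GRing.Theory Num.Theory.
Local Open Scope classical_set_scope.
Local Open Scope ring_scope.

(** The theorem rests on the control that the class of [omega] in Zhu's algebra
    exerts on the eigenvalues of L(0).

    The algebra A(V) is associative and the class of [omega] is central in it
    ([zhu_starA], [zhu_star_omega]). As V has finite-dimensional weight spaces,
    A(V) has countable dimension, and over the uncountable field of complex
    numbers Schur's lemma still holds: [omega] acts by a scalar on each minimal
    left ideal ([schur_dixmier]). If A(V) is semisimple, the unit is a finite sum
    of elements of minimal left ideals, so there is a finite list of scalars [c]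
    for which the product of the [omega - c] vanishes in A(V)
    ([semisimple_unit]).

    Let M be an admissible module. Modulo a submodule that contains all degrees
    below [n], the zero modes make the degree [n] part of M a module over A(V)
    ([zero_mode_O], [zero_mode_star]) on which [omega] acts as L(0). Hence the
    product of the [L(0) - c] maps M_n into that submodule ([split_op_top]).
    Since [L(0) - d] commutes with all modes, its generalized eigenspaces are
    submodules, and induction on [n] shows that its eigenvalues on M_n are of the
    form [c - j] with [0 <= j <= n] ([degree_torsion]). So M is the sum of the
    generalized eigenspaces of L(0) for eigenvalues in finitely many sets
    [c + N] ([amod_torsion]).

    In each coset modulo the integers that contains an eigenvalue of L(0) on M
    there is therefore a least one, and there are finitely many such least
    eigenvalues; these are the [lambda_i]. An eigenvector [u] for [lambda_i]
    generates a submodule on which L(0) is diagonalizable with eigenvalues in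
    [lambda_i + N], and the quotient of that submodule by a submodule maximal
    among those that do not contain [u] is irreducible of lowest weight
    [lambda_i] ([irreducible_lowest_weight]). Every generalized eigenspace
    belongs to exactly one of the sets [lambda_i + N]; as modes shift eigenvalues
    by integers and nothing occurs below [lambda_i], the corresponding summand is
    a submodule. *)

(** * Linear maps, subspaces and direct sums *)

Section LinearMaps.
Context {K : nzRingType} {E E' : lmodType K} (f : E -> E').
Hypothesis fL : linear f.

Lemma lin0 : f 0 = 0.
Proof.
by have := fL (-1) 0 0; rewrite scaler0 addr0 scaleN1r addNr.
Qed.
Lemma linD u v : f (u + v) = f u + f v.
Proof. by rewrite -[u]scale1r fL !scale1r. Qed.
Lemma linZ c u : f (c *: u) = c *: f u.
Proof. by rewrite -[c *: u]addr0 fL lin0 addr0. Qed.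
Lemma linN u : f (- u) = - f u.
Proof. by rewrite -scaleN1r linZ scaleN1r. Qed.
Lemma linB u v : f (u - v) = f u - f v.
Proof. by rewrite linD linN. Qed.
Lemma lin_sum (I : Type) (r : seq I) (P : pred I) (F : I -> E) :
  f (\sum_(i <- r | P i) F i) = \sum_(i <- r | P i) f (F i).
Proof.
elim/big_rec2: _ => [|i x y _ <-]; first exact: lin0.
exact: linD.
Qed.
End LinearMaps.

Section Subspaces.
Context {K : nzRingType} {E : lmodType K}.
Implicit Types (W S : set E).

Lemma subspace0 W : subspace W -> W 0.
Proof. by case. Qed.
Lemma subspaceD W u v : subspace W -> W u -> W v -> W (u + v).
Proof. by case=> _ WD _; exact: WD. Qed.
Lemma subspaceZ W c u : subspace W -> W u -> W (c *: u).
Proof. by case=> _ _; exact. Qed.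
Lemma subspaceB W u v : subspace W -> W u -> W v -> W (u - v).
Proof.
by move=> sW Wu Wv; rewrite -scaleN1r; apply: subspaceD => //; exact: subspaceZ.
Qed.
Lemma subspace_sum W (I : eqType) (r : seq I) (F : I -> E) :
  subspace W -> (forall i, i \in r -> W (F i)) -> W (\sum_(i <- r) F i).
Proof.
move=> sW WF; rewrite big_seq; elim/big_ind: _ => [|x y Wx Wy|] //.
  exact: subspace0.
exact: subspaceD.
Qed.

Lemma lin_span_incl S : S `<=` lin_span S.
Proof. by move=> u Su W _; exact. Qed.

Lemma lin_span_min S W : subspace W -> S `<=` W -> lin_span S `<=` W.
Proof. by move=> sW SW u; exact. Qed.

Lemma lin_spanK W : subspace W -> lin_span W = W.
Proof.
by move=> sW; apply/seteqP; split; [exact: lin_span_min|exact: lin_span_incl].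
Qed.

End Subspaces.

Lemma preimage_subspace (K : nzRingType) (E E' : lmodType K) (f : E -> E')
    (W : set E') : linear f -> subspace W -> subspace (f @^-1` W).
Proof.
move=> fL sW; split=> [|u v|c u] /=; first by rewrite lin0 //; exact: subspace0.
  by rewrite linD //; exact: subspaceD.
by rewrite linZ //; exact: subspaceZ.
Qed.

Lemma linear_subf (K : nzRingType) (E E' : lmodType K) (f g : E -> E') :
  linear f -> linear g -> linear (fun u => f u - g u).
Proof. by move=> fL gL c u v; rewrite fL gL scalerBr opprD addrACA. Qed.

Lemma linear_compf (K : nzRingType) (E E' E'' : lmodType K) (f : E -> E')
  (g : E' -> E'') : linear f -> linear g -> linear (fun u => g (f u)).
Proof. by move=> fL gL c u v; rewrite fL gL. Qed.

Lemma linear_scalef (K : comNzRingType) (E E' : lmodType K) (d : K) (f : E -> E') :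
  linear f -> linear (fun u => d *: f u).
Proof. by move=> fL c u v; rewrite fL scalerDr !scalerA mulrC. Qed.

Lemma equalizer_subspace (K : nzRingType) (E E' : lmodType K) (f g : E -> E') :
  linear f -> linear g -> subspace [set u | f u = g u].
Proof.
move=> fL gL; split=> [|u v /= fu fv|c u /= fu] /=.
- by rewrite !lin0.
- by rewrite !linD // fu fv.
- by rewrite !linZ // fu.
Qed.

Section Decompositions.
Context {K : nzRingType} {E : lmodType K} {I : choiceType}.
Implicit Types (F : I -> set E) (f g : I -> E).

Lemma fsum_seq (r : seq I) f : uniq r -> (forall i, i \notin r -> f i = 0) ->
  \sum_(i \in [set: I]) f i = \sum_(i <- r) f i.
Proof.
move=> ur r0; rewrite (fsbigE r) //; last by move=> i _; exact: r0.
by apply: eq_bigl => i; rewrite in_setT.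
Qed.

Lemma finite_support_seq f : finite_set [set i | f i != 0] ->
  exists2 r : seq I, uniq r & forall i, i \notin r -> f i = 0.
Proof.
move=> /finite_seqP[r rE]; exists (undup r); first exact: undup_uniq.
move=> i; rewrite mem_undup => ir; apply/eqP; apply: contraNT ir => fi.
by have : [set i | f i != 0] i by []; rewrite rE.
Qed.

Lemma support_finite (r : seq I) f : (forall i, i \notin r -> f i = 0) ->
  finite_set [set i | f i != 0].
Proof.
move=> r0; apply: (@sub_finite_set _ _ [set` r]) => // i /=.
by apply: contraNT => /r0 ->.
Qed.

Lemma decomposesP F u f : decomposes F u f <-> (forall i, F i (f i)) /\
  exists r, [/\ uniq r, forall i, i \notin r -> f i = 0 & u = \sum_(i <- r) f i].
Proof.
split=> [[Ff fin ->]|[Ff [r [ur r0 ->]]]].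
  have [r ur r0] := finite_support_seq fin; split=> //; exists r; split=> //.
  exact: fsum_seq.
by split=> //; [exact: support_finite r0 | rewrite (fsum_seq ur)].
Qed.

Lemma common_support f g :
  finite_set [set i | f i != 0] -> finite_set [set i | g i != 0] ->
  exists r : seq I, [/\ uniq r, forall i, i \notin r -> f i = 0
    & forall i, i \notin r -> g i = 0].
Proof.
move=> /finite_support_seq[r _ r0] /finite_support_seq[s _ s0].
exists (undup (r ++ s)); split=> [|i|i]; first exact: undup_uniq.
all: by rewrite mem_undup mem_cat negb_or => /andP[? ?]; auto.
Qed.

Lemma decomposesD F u v f g : (forall i, subspace (F i)) ->
  decomposes F u f -> decomposes F v g ->
  decomposes F (u + v) (fun i => f i + g i).
Proof.
move=> sF [Ff f0 ->] [Fg g0 ->]; have [r [ur rf rg]] := common_support f0 g0.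
apply/decomposesP; split=> [i|]; first exact: subspaceD.
exists r; split=> // [i ir|]; first by rewrite rf // rg // addr0.
by rewrite (fsum_seq ur rf) (fsum_seq ur rg) big_split.
Qed.

Lemma decomposesZ F u f c : (forall i, subspace (F i)) ->
  decomposes F u f -> decomposes F (c *: u) (fun i => c *: f i).
Proof.
move=> sF /decomposesP[Ff [r [ur rf ->]]].
apply/decomposesP; split=> [i|]; first exact: subspaceZ.
exists r; split=> // [i ir|]; first by rewrite rf // scaler0.
by rewrite scaler_sumr.
Qed.

Lemma decomposes1 F i u : (forall j, subspace (F j)) -> F i u ->
  decomposes F u (fun j => if j == i then u else 0).
Proof.
move=> sF Fu; apply/decomposesP; split=> [j|].
  by case: eqP => [->|_] //; exact: subspace0.
exists [:: i]; split=> // [j|]; first by rewrite inE => /negPf ->.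
by rewrite big_seq1 eqxx.
Qed.

Lemma sum_space_subspace F : (forall i, subspace (F i)) ->
  subspace (sum_space F).
Proof.
move=> sF; split=> [|u v [f uf] [g vg]|c u [f uf]].
- exists (fun=> 0); apply/decomposesP; split=> [i|]; first exact: subspace0.
  by exists [::]; rewrite big_nil.
- by exists (fun i => f i + g i); exact: decomposesD.
- by exists (fun i => c *: f i); exact: decomposesZ.
Qed.

Lemma sum_space_incl F i : (forall i, subspace (F i)) -> F i `<=` sum_space F.
Proof. by move=> sF u Fu; eexists; exact: decomposes1 Fu. Qed.

Lemma sum_space_min F W : subspace W -> (forall i, F i `<=` W) ->
  sum_space F `<=` W.
Proof.
move=> sW FW u [f /decomposesP[Ff [r [_ _ ->]]]]; apply: subspace_sum => // i _.
exact: FW.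
Qed.

(** The difference of two decompositions of a vector is a decomposition of 0. *)
Lemma independent0 F : (forall i, subspace (F i)) ->
  (forall f, decomposes F 0 f -> f = fun=> 0) -> independent F.
Proof.
move=> sF F0 u f g uf ug; have := decomposesZ (-1) sF ug.
move=> /(decomposesD sF uf); rewrite scaleN1r subrr => /F0 /funeqP fg.
apply/funext => i; apply/eqP; rewrite -subr_eq0 -scaleN1r; apply/eqP.
exact: fg.
Qed.

End Decompositions.

Section Graded.
Context {K : nzRingType} {E E' : lmodType K} {I : choiceType} (F : I -> set E).
Hypothesis Fsub : forall i, subspace (F i).
Hypothesis FE : direct_sum F setT.

Lemma componentsP u : decomposes F u (components F u).
Proof.
have [_ sF] := FE; have : sum_space F u by rewrite sF.
by case=> f uf; exact: (xgetPex (fun=> 0) (ex_intro _ f uf)).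
Qed.

Lemma components_unique u f : decomposes F u f -> components F u = f.
Proof. by have [iF _] := FE; move=> uf; exact: iF (componentsP u) uf. Qed.

Lemma components_in u i : F i (components F u i).
Proof. by have [] := componentsP u. Qed.

Lemma components_homog i u : F i u ->
  components F u = fun j => if j == i then u else 0.
Proof. by move=> Fu; apply: components_unique; exact: decomposes1. Qed.

Lemma components_lin c u v : components F (c *: u + v) =
  fun i => c *: components F u i + components F v i.
Proof.
apply: components_unique; apply: decomposesD => //; last exact: componentsP.
by apply: decomposesZ => //; exact: componentsP.
Qed.

Lemma components_sum u : exists r, [/\ uniq r,
  forall i, i \notin r -> components F u i = 0
  & u = \sum_(i <- r) components F u i].
Proof. by have /decomposesP[] := componentsP u. Qed.

Lemma graded_ind (W : set E) : subspace W -> (forall i, F i `<=` W) ->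
  forall u, W u.
Proof.
move=> sW FW u; have [r [_ _ ->]] := components_sum u.
by apply: subspace_sum => // i _; apply: (FW i); exact: components_in.
Qed.

(** Zhu's products, the zero modes and the degree operator are all of this form:
    linearity and the value on homogeneous vectors are established here for all
    of them. *)
Definition graded_ext (phi : I -> E -> E') (u : E) : E' :=
  \sum_(i \in [set: I]) phi i (components F u i).

Lemma graded_ext_linear phi : (forall i, linear (phi i)) ->
  linear (graded_ext phi).
Proof.
move=> phiL c u v; rewrite /graded_ext components_lin.
have [r [ur ru rv]] := common_support
  (let: And3 _ h _ := componentsP u in h) (let: And3 _ h _ := componentsP v in h).
have phi0 i : phi i 0 = 0 by exact: lin0.
rewrite (fsum_seq ur); last by move=> i ir; rewrite ru // rv // scaler0 addr0.
rewrite (fsum_seq ur (f := fun i => phi i (components F u i))); last first.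
  by move=> i /ru ->.
rewrite (fsum_seq ur (f := fun i => phi i (components F v i))); last first.
  by move=> i /rv ->.
by rewrite scaler_sumr -big_split; apply: eq_bigr => i _ /=; rewrite phiL.
Qed.

Lemma graded_ext_homog phi i u : (forall i, linear (phi i)) -> F i u ->
  graded_ext phi u = phi i u.
Proof.
move=> phiL Fu; rewrite /graded_ext (components_homog Fu) (fsum_seq (r := [:: i])) //.
  by rewrite big_seq1 eqxx.
by move=> j; rewrite inE => /negPf ->; rewrite lin0.
Qed.

End Graded.

(** * Generalized eigenspaces *)

Section GeneralizedEigenspaces.
Context {K : fieldType} {E : lmodType K} (T : E -> E).
Hypothesis TL : linear T.
Implicit Types (c : K) (s : seq K) (u : E) (X Y : set K).

(** A split polynomial in [T] is given by the list [s] of its roots, so that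
    composition of operators is concatenation of lists. *)
Definition split_op s u := foldr (fun c v => T v - c *: v) u s.

Definition gen_eigenspace c : set E :=
  [set u | exists k : nat, iter k (fun v => T v - c *: v) u = 0].

(** The vectors annihilated by a polynomial in [T] that splits with all its
    roots in [X]; by [torsion_min] this is the sum of the generalized eigenspaces
    for the eigenvalues in [X]. *)
Definition torsion X : set E :=
  [set u | exists2 s, (forall c, c \in s -> X c) & split_op s u = 0].

Lemma sub_scale_linear c : linear (fun v => T v - c *: v).
Proof.
move=> a u v; rewrite TL scalerDr opprD addrACA scalerBr !scalerA.
by rewrite [c * a]mulrC.
Qed.

Lemma split_op_linear s : linear (split_op s).
Proof.
elim: s => [|c s IH] a u v //=; rewrite IH; exact: (sub_scale_linear c a).
Qed.

Lemma split_op_cat s t u : split_op (s ++ t) u = split_op s (split_op t u).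
Proof. exact: foldr_cat. Qed.

Lemma split_op_comm (D : E -> E) : linear D -> (forall u, D (T u) = T (D u)) ->
  forall s u, D (split_op s u) = split_op s (D u).
Proof.
move=> DL DT; elim=> [|c s IH] u //=.
by rewrite (linB DL) (linZ DL) DT IH.
Qed.

Lemma split_op_factor c s u :
  split_op s (T u - c *: u) = T (split_op s u) - c *: split_op s u.
Proof.
symmetry; apply: (split_op_comm (sub_scale_linear c)) => v.
by rewrite (linB TL) (linZ TL).
Qed.

Lemma split_op_swap s t u : split_op s (split_op t u) = split_op t (split_op s u).
Proof.
elim: t u => [|c t IH] u //=; rewrite split_op_factor IH //.
Qed.

Lemma split_op_eigen s c u : T u = c *: u ->
  split_op s u = (\prod_(d <- s) (c - d)) *: u.
Proof.
move=> Tu; elim: s => [|d s IH] /=; first by rewrite big_nil scale1r.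
rewrite IH linZ // Tu big_cons !scalerA -scalerBl; congr (_ *: _); ring.
Qed.

Lemma split_op0 s : split_op s 0 = 0.
Proof. exact: lin0 (split_op_linear s). Qed.

Lemma torsion_subspace X : subspace (torsion X).
Proof.
split=> [|u v [s sX u0] [t tX v0]|c u [s sX u0]]; first by exists [::].
- exists (s ++ t); first by move=> d; rewrite mem_cat => /orP[/sX|/tX].
  rewrite (linD (split_op_linear _)) !split_op_cat split_op_swap u0 v0 !split_op0.
  by rewrite addr0.
- by exists s => //; rewrite (linZ (split_op_linear s)) u0 scaler0.
Qed.

Lemma torsionS X Y : X `<=` Y -> torsion X `<=` torsion Y.
Proof. by move=> XY u [s sX u0]; exists s => // c /sX /XY. Qed.

Lemma torsion_stable X (D : E -> E) : linear D ->
  (forall u, D (T u) = T (D u)) -> forall u, torsion X u -> torsion X (D u).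
Proof.
move=> DL DT u [s sX u0]; exists s => //.
by rewrite -(split_op_comm DL DT) u0 lin0.
Qed.

Lemma split_op_stable W s u : subspace W -> (forall v, W v -> W (T v)) ->
  W u -> W (split_op s u).
Proof.
move=> sW WT Wu; elim: s => //= c s IH.
by apply: subspaceB => //; [exact: WT|exact: subspaceZ].
Qed.

Lemma split_op_nseq k c u : split_op (nseq k c) u = iter k (fun v => T v - c *: v) u.
Proof. by elim: k => //= k ->. Qed.

Lemma gen_eigenspace_torsion c : gen_eigenspace c `<=` torsion [set c].
Proof.
move=> u [k u0]; exists (nseq k c); last by rewrite split_op_nseq.
by move=> d; rewrite mem_nseq => /andP[_ /eqP ->].
Qed.

Lemma torsion_gen_eigenspace c : torsion [set c] `<=` gen_eigenspace c.
Proof.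
move=> u [s sc u0]; exists (size s); rewrite -split_op_nseq -u0; congr split_op.
by symmetry; apply/all_pred1P; apply/allP => d /sc /= ->; exact/eqP.
Qed.

Lemma gen_eigenspace_subspace c : subspace (gen_eigenspace c).
Proof.
have -> : gen_eigenspace c = torsion [set c]; last exact: torsion_subspace.
apply/seteqP; split; [exact: gen_eigenspace_torsion|exact: torsion_gen_eigenspace].
Qed.

(** Two products of factors without common root are coprime, so nothing but 0
    is annihilated by both. *)
Lemma torsion_disjoint X Y u : (forall c, X c -> Y c -> False) ->
  torsion X u -> torsion Y u -> u = 0.
Proof.
move=> XY [s sX u0] [t tY v0]; elim: s sX u0 => [|c s IH] sX //= u0.
apply: IH => [d ds|]; first by apply: sX; rewrite inE ds orbT.
set w := split_op s u in u0 *.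
have Tw : T w = c *: w by apply/eqP; rewrite -subr_eq0 u0.
have : split_op t w = 0 by rewrite /w split_op_swap v0 split_op0.
rewrite (split_op_eigen _ Tw) => /eqP; rewrite scaler_eq0 => /orP[|/eqP //].
rewrite prodf_seq_eq0 => /hasP[d dt] /= /eqP/subr0_eq cd.
case: (XY c); first by apply: sX; rewrite mem_head.
by rewrite cd; exact: tY.
Qed.

(** On the generalized eigenspace for [d], the operator [T - c] is invertible
    when [c] is not [d]: it is a nilpotent operator plus the scalar [d - c]. *)
Lemma gen_eigenspace_solve c d w : c != d -> gen_eigenspace d w ->
  exists2 x, gen_eigenspace d x & T x - c *: x = w.
Proof.
have sd := gen_eigenspace_subspace d.
move=> cd [k]; elim: k w => [|k IH] w.
  by move=> /= ->; exists 0; [exact: subspace0|rewrite (lin0 TL) scaler0 subr0].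
move=> wk; have dw : gen_eigenspace d w by exists k.+1.
move: wk; rewrite iterSr => /IH[x dx xE].
have dc : d - c != 0 by rewrite subr_eq0 eq_sym.
exists ((d - c)^-1 *: (w - x)).
  by apply: subspaceZ => //; exact: subspaceB.
rewrite (linZ TL) scalerA mulrC -scalerA -scalerBr (linB TL).
have -> : T w - T x - c *: (w - x) = (d - c) *: w.
  have -> : T w - T x - c *: (w - x) = T w - (T x - c *: x) - c *: w.
    by rewrite scalerBr !opprB !addrA; congr (_ - _); rewrite addrAC.
  by rewrite xE opprB [T w + _]addrC subrK scalerBl.
by rewrite scalerA mulVf // scale1r.
Qed.

(** By induction on the list of roots: let [T - c] be the factor applied first.
    The components of [T u - c u] for the other eigenvalues are lifted through
    [T - c] by [gen_eigenspace_solve], and what then remains of [u] is in the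
    generalized eigenspace for [c]. *)
Lemma torsion_min X W : subspace W -> (forall c, X c -> gen_eigenspace c `<=` W) ->
  torsion X `<=` W.
Proof.
move=> sW XW u [s sX u0].
have sF := gen_eigenspace_subspace; pose F (c : K) := gen_eigenspace c.
suff : exists f : K -> E, (forall c, F c (f c)) /\ u = \sum_(c <- undup s) f c.
  case=> f [Ff ->]; apply: subspace_sum => // c; rewrite mem_undup => /sX Xc.
  exact: XW (Ff c).
elim: s {sX} u u0 => [|c s IH] u /=.
  move=> ->; exists (fun=> 0); rewrite big_nil; split=> // c.
  exact: subspace0.
rewrite -split_op_factor => /IH[f [Ff uE]].
have solve d : exists x, F d x /\ (d != c -> T x - c *: x = f d).
  have [->|dc] := eqVneq d c.
    by exists 0; split=> //; exact: subspace0.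
  have [|x] := @gen_eigenspace_solve c d (f d) _ (Ff d).
    by rewrite eq_sym.
  by exists x.
have [g gP] := choice solve.
pose v := \sum_(d <- undup s | d != c) g d.
have vE : T v - c *: v = \sum_(d <- undup s | d != c) f d.
  rewrite (lin_sum (sub_scale_linear c)).
  by apply: eq_bigr => d dc; exact: (gP d).2.
have cz : F c (u - v).
  suff : F c (T (u - v) - c *: (u - v)) by case=> m um; exists m.+1; rewrite iterSr.
  rewrite (linB (sub_scale_linear c)) uE vE (bigID (pred1 c)) /= addrK.
  rewrite big_mkcond /=; apply: subspace_sum => // i _.
  by case: eqP => [->|_]; [exact: Ff|exact: subspace0].
exists (fun d => if d == c then u - v else g d); split=> [d|].
  by case: eqP => [->|_] //; exact: (gP d).1.
rewrite (bigID (pred1 c)) /= (_ : \sum_(i <- _ | i == c) _ = u - v).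
  rewrite -[LHS](subrK v); congr (_ + _).
  case: ifP => cs; first by apply: eq_bigr => i /negPf ->.
  by rewrite big_cons eqxx; apply: eq_bigr => i /negPf ->.
rewrite (eq_bigr (fun=> u - v)) => [|i /eqP ->]; last by rewrite eqxx.
rewrite big_const_seq (_ : count _ _ = 1%N) /= ?addr0 //.
have := count_uniq_mem c (undup_uniq (c :: s)); rewrite mem_undup mem_head /=.
exact.
Qed.

(** If a family adds up to 0, each member is minus the sum of the others, hence
    annihilated by two polynomials without common root. *)
Lemma torsion_independent (I : choiceType) (X : I -> set K) :
  (forall i j c, X i c -> X j c -> i = j) -> independent (fun i => torsion (X i)).
Proof.
move=> Xdis; apply: independent0 => [i|f]; first exact: torsion_subspace.
move=> /decomposesP[Ff [r [ur r0 sum0]]]; apply/funext => j.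
have [jr|/r0 //] := boolP (j \in r).
pose Y := [set c | exists2 i, i != j & X i c].
apply: (@torsion_disjoint (X j) Y) => //.
  by move=> c Xj [i ij /(Xdis _ _ _ Xj) ji]; rewrite ji eqxx in ij.
have -> : f j = - \sum_(i <- r | i != j) f i.
  by apply/eqP; rewrite -addr_eq0 -(bigD1_seq j) //= -sum0.
rewrite -scaleN1r; apply: subspaceZ; first exact: torsion_subspace.
rewrite big_mkcond; apply: subspace_sum => [|i _]; first exact: torsion_subspace.
case: ifP => ij; last by apply: subspace0; exact: torsion_subspace.
by apply: torsionS (Ff i) => c Xc; exists i.
Qed.

End GeneralizedEigenspaces.

Lemma independentS (K : nzRingType) (E : lmodType K) (I : choiceType)
    (F G : I -> set E) :
  (forall i, F i `<=` G i) -> independent G -> independent F.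
Proof.
move=> FG iG u f g [Ff f0 uf] [Fg g0 ug]; apply: (iG u); split=> // i.
  exact/FG/Ff.
exact/FG/Fg.
Qed.


(** * Binomial coefficients and finitely supported sums *)

Section Binomials.
Context {R : realType}.
Local Notation C := R[i].
Implicit Types (m n : int) (i j : nat).

Lemma natS_neq0 i : i.+1%:R != 0 :> C.
Proof. by rewrite Num.Theory.pnatr_eq0. Qed.

Lemma binz0 m : binz m 0 = 1 :> C.
Proof. by rewrite /binz big_ord0 fact0 divr1. Qed.

Lemma binzS_mul m i :
  binz m i.+1 * i.+1%:R = binz m i * (m%:~R - i%:R) :> C.
Proof.
rewrite /binz big_ord_recr /= factS natrM invfM.
by rewrite -[LHS]mulrA [_^-1 * _ * _]mulrAC mulVf ?natS_neq0 // mul1r mulrAC.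
Qed.

Lemma binz_absorb m i :
  binz (m + 1) i.+1 * i.+1%:R = (m + 1)%:~R * binz m i :> C.
Proof.
rewrite /binz big_ord_recl /= factS natrM invfM subr0.
rewrite -[LHS]mulrA [_^-1 * _ * _]mulrAC mulVf ?natS_neq0 // mul1r -mulrA.
congr (_ * (_ / _)).
by apply: eq_bigr => j _; rewrite /bump /= intrD natrD; ring.
Qed.

Lemma binz_pascal m i : binz (m + 1) i.+1 = binz m i.+1 + binz m i :> C.
Proof.
apply: (mulIf (natS_neq0 i)); rewrite binz_absorb mulrDl binzS_mul.
by rewrite -addn1 natrD intrD; ring.
Qed.

Lemma binz_top m i :
  binz (m + 1) i * ((m + 1)%:~R - i%:R) = (m + 1)%:~R * binz m i :> C.
Proof. by rewrite -binzS_mul binz_absorb. Qed.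

Lemma binz_small (n i : nat) : (n < i)%N -> binz n i = 0 :> C.
Proof.
move=> ni; rewrite /binz (bigD1 (Ordinal ni)) //= -pmulrn subrr.
by rewrite !mul0r.
Qed.

Lemma binz0n i : binz 0 i = (i == 0)%:R :> C.
Proof. by case: i => [|i]; [rewrite binz0|rewrite (@binz_small 0)]. Qed.

(** Both sides satisfy Pascal's rule in [m], which determines them from [m = 0]
    upwards, and downwards by induction on [i]. *)
Lemma binz_vandermonde m n i :
  \sum_(j < i.+1) binz m (i - j) * binz n j = binz (m + n) i :> C.
Proof.
pose S m i : C := \sum_(j < i.+1) binz m (i - j) * binz n j.
have S0 k : S k 0%N = 1 by rewrite /S big_ord1 !binz0 mulr1.
have SP k j : S (k + 1) j.+1 = S k j.+1 + S k j.
  rewrite /S big_ord_recr [in RHS]big_ord_recr /= subnn !binz0 addrAC.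
  congr (_ + _); rewrite -big_split /=; apply: eq_bigr => t _.
  by rewrite subSn ?binz_pascal ?mulrDl // -ltnS.
rewrite -/(S m i); elim/int_ind: m i => [|m IH|m IH] i.
- rewrite /S big_ord_recr /= subnn binz0 mul1r add0r big1 ?add0r // => j _.
  by rewrite binz0n subn_eq0 leqNgt ltn_ord mul0r.
- case: i => [|i]; first by rewrite S0 binz0.
  rewrite -addn1 PoszD SP !IH addrAC.
  by rewrite binz_pascal.
- elim: i => [|i IHi]; first by rewrite S0 binz0.
  have := SP (- (m.+1)%:Z) i; have -> : - m.+1%:Z + 1 = - m%:Z by lia.
  rewrite IH IHi; have -> : - m%:Z + n = (- m.+1%:Z + n) + 1 by lia.
  by rewrite binz_pascal => /addIr.
Qed.

Lemma binz_neg m i : binz (- m) i = (-1) ^+ i * binz (m + i%:Z - 1) i :> C.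
Proof.
elim: i m => [|i IH] m; first by rewrite !binz0 mulr1.
apply: (mulIf (natS_neq0 i)); rewrite binzS_mul IH -[RHS]mulrA.
have -> : m + i.+1%:Z - 1 = (m + i%:Z - 1) + 1 by lia.
rewrite binz_absorb exprS !intrD intrN -!pmulrn; ring.
Qed.

Lemma binz_diag i : binz i i = 1 :> C.
Proof.
elim: i => [|i IH]; first exact: binz0.
apply: (mulIf (natS_neq0 i)); have -> : i.+1%:Z = i%:Z + 1 by lia.
by rewrite binz_absorb IH mulr1 mul1r intrD natr1.
Qed.

Lemma binz_neg2 i : binz (-2) i = (-1) ^+ i * i.+1%:R :> C.
Proof.
rewrite binz_neg (_ : 2 + i%:Z - 1 = i%:Z + 1); last by lia.
have := binz_top i i; rewrite binz_diag mulr1 intrD -!pmulrn.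
by rewrite [_ + _ - _]addrAC subrr add0r mulr1 natr1 => ->.
Qed.

Lemma binz_trinomial m e r : binz m (e + r) * binz (e + r)%N e =
  binz m e * binz (m - e%:Z) r :> C.
Proof.
elim: r => [|r IH].
  by rewrite addn0 binz0 binz_diag mulr1.
apply: (mulIf (natS_neq0 r)).
rewrite -[RHS]mulrA binzS_mul [RHS]mulrA -IH addnS.
have top : binz (e + r).+1 e * r.+1%:R = (e + r).+1%:R * binz (e + r)%N e :> C.
  have := binz_top (e + r)%N e; have -> : (e + r)%:Z + 1 = (e + r).+1%:Z by lia.
  rewrite -!pmulrn (_ : _ - _ = r.+1%:R) //.
  by rewrite -addnS natrD [e%:R + _]addrC addrK.
rewrite -[LHS]mulrA top [LHS]mulrA binzS_mul [LHS]mulrAC; congr (_ * _).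
by rewrite natrD intrB -!pmulrn opprD addrA.
Qed.

End Binomials.

Section Sums.
Context {K : nzRingType} {E : lmodType K}.

Lemma fsum_nat N (f : nat -> E) : (forall i, (N <= i)%N -> f i = 0) ->
  \sum_(i \in [set: nat]) f i = \sum_(i < N) f i.
Proof.
move=> f0; rewrite (fsum_seq (iota_uniq 0 N)) => [|i].
  by rewrite -(big_mkord xpredT) /index_iota subn0.
by rewrite mem_iota leq0n add0n /= -leqNgt; exact: f0.
Qed.

Lemma fsum_single (j : nat) (f : nat -> E) : (forall i, i != j -> f i = 0) ->
  \sum_(i \in [set: nat]) f i = f j.
Proof.
move=> f0; rewrite (fsum_seq (r := [:: j])) ?big_seq1 // => i.
by rewrite inE; exact: f0.
Qed.

Lemma fsum0 (I : choiceType) (f : I -> E) : (forall i, f i = 0) ->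
  \sum_(i \in [set: I]) f i = 0.
Proof. by move=> f0; rewrite (fsum_seq (r := [::])) ?big_nil. Qed.

Lemma fsum_in (I : choiceType) (W : set E) (f : I -> E) : subspace W ->
  (forall i, W (f i)) -> W (\sum_(i \in [set: I]) f i).
Proof. by move=> sW Wf; apply: subspace_sum. Qed.

(** The terms are collected by the value of [s + t]. Those with [s + t >= N]
    vanish, so the ranges of both sums may be longer than [N], and different. *)
Lemma sum_convolution N N1 N2 (A : nat -> nat -> K) (y : nat -> E) :
  (forall n, (N <= n)%N -> y n = 0) -> (N <= N1)%N -> (N <= N2)%N ->
  \sum_(s < N1) \sum_(t < N2) A s t *: y (s + t)%N =
  \sum_(u < N) (\sum_(j < u.+1) A (u - j)%N j) *: y u.
Proof.
move=> y0 N1N N2N.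
transitivity (\sum_(u < N) \sum_(t < N2) \sum_(s < N1)
    (if s == (u - t)%N :> nat then if (t <= u)%N then A s t *: y u else 0 else 0)).
  rewrite exchange_big /=; symmetry; rewrite exchange_big /=.
  apply: eq_bigr => t _; rewrite exchange_big /=; apply: eq_bigr => s _.
  have [stN|Nst] := ltnP (s + t) N.
    rewrite (bigD1 (Ordinal stN)) //= addnK eqxx leq_addl big1 ?addr0 // => u.
    by rewrite -val_eqE /= => /eqP un; case: eqP => // sE; case: leqP => // tu; lia.
  rewrite y0 // scaler0 big1 // => u _.
  by case: eqP => // sE; case: leqP => // tu; have := ltn_ord u; lia.
apply: eq_bigr => u _; rewrite scaler_suml (big_ord_widen N2 (fun j => A (u - j)%N j *: y u)).
  rewrite [RHS]big_mkcond; apply: eq_bigr => t _ /=.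
  have utN : (u - t < N1)%N by have := ltn_ord u; lia.
  rewrite (bigD1 (Ordinal utN)) //= eqxx ltnS big1 ?addr0 // => s.
  by rewrite -val_eqE /= => /negPf ->.
exact: leq_trans (ltn_ord u) _.
Qed.

End Sums.

(** * Modes and the Jacobi identity *)

Section Modes.
Context {R : realType} {V M : lmodType R[i]} (Y : V -> int -> M -> M).
Local Notation C := R[i].
Hypotheses (Ybil : bilinear_modes Y) (Ytr : truncated Y).
Implicit Types (a b : V) (u v : M) (n p q : int) (N : nat).

Lemma Ylinl n u : linear (fun a => Y a n u).
Proof. by case: Ybil. Qed.
Lemma Ylinr a n : linear (Y a n).
Proof. by case: Ybil. Qed.

(** The truncation point is counted from [p] because the residue [res_mode al p]
    below sums the modes from [a(p)] on. *)
Definition vanish_from a u p N := forall n, p + N%:Z <= n -> Y a n u = 0.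

Lemma vanish_from_ex a u p : exists N0 : nat,
  forall N, (N0 <= N)%N -> vanish_from a u p N.
Proof.
have [n0 hn] := Ytr a u; exists `|n0 - p|%N => N N0N n pn; apply: hn; lia.
Qed.

(** [res_mode al p a] is the coefficient extraction
    [Res_z (1 + z)^al z^p Y(a,z)]. *)
Definition res_mode (al p : int) a u : M :=
  \sum_(i \in [set: nat]) binz al i *: Y a (p + i%:Z) u.

Lemma res_mode_fin al p a u N : vanish_from a u p N ->
  res_mode al p a u = \sum_(i < N) binz al i *: Y a (p + i%:Z) u.
Proof.
move=> aN; rewrite /res_mode (fsum_nat (N := N)) // => i Ni.
by rewrite aN ?scaler0 //; lia.
Qed.

Lemma res_mode0 p a u : res_mode 0 p a u = Y a p u.
Proof.
rewrite /res_mode (fsum_nat (N := 1)) => [|i i0].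
  by rewrite big_ord1 binz0 scale1r addr0.
by rewrite binz0n eqn0Ngt i0 scale0r.
Qed.

Lemma res_mode_linl al p u : linear (fun a => res_mode al p a u).
Proof.
move=> c a b; have [N0 aN] := vanish_from_ex a u p.
have [N1 bN] := vanish_from_ex b u p; pose N := maxn N0 N1.
have {}aN : vanish_from a u p N by exact/aN/leq_maxl.
have {}bN : vanish_from b u p N by exact/bN/leq_maxr.
rewrite !(res_mode_fin _ (N := N)) => [|//|//|n pn].
  rewrite scaler_sumr -big_split; apply: eq_bigr => i _ /=.
  by rewrite (Ylinl _ _) scalerDr !scalerA mulrC.
by rewrite (Ylinl _ _) aN // bN // scaler0 addr0.
Qed.

Lemma res_mode_linr al p a : linear (res_mode al p a).
Proof.
move=> c u v; have [N0 uN] := vanish_from_ex a u p.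
have [N1 vN] := vanish_from_ex a v p; pose N := maxn N0 N1.
have {}uN : vanish_from a u p N by exact/uN/leq_maxl.
have {}vN : vanish_from a v p N by exact/vN/leq_maxr.
rewrite !(res_mode_fin _ (N := N)) => [|//|//|n pn].
  rewrite scaler_sumr -big_split; apply: eq_bigr => i _ /=.
  by rewrite (Ylinr _ _) scalerDr !scalerA mulrC.
by rewrite (Ylinr _ _) uN // vN // scaler0 addr0.
Qed.

Lemma res_mode_pascal al p a u :
  res_mode (al + 1) p a u = res_mode al p a u + res_mode al (p + 1) a u.
Proof.
have [N aN] := vanish_from_ex a u p.
have aN0 : vanish_from a u p N by exact: aN.
have aN1 : vanish_from a u p N.+1 by exact: aN.
have aN2 : vanish_from a u (p + 1) N by move=> n pn; apply: aN1; lia.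
rewrite (res_mode_fin _ aN1) (res_mode_fin al aN1) (res_mode_fin _ aN2) !big_ord_recl !binz0.
rewrite -addrA; congr (_ + _); rewrite -big_split /=; apply: eq_bigr => i _.
rewrite /bump /= add1n binz_pascal scalerDl; congr (_ + _ *: Y a _ u); lia.
Qed.

End Modes.

Section JacobiConsequences.
Context {R : realType} (V : VOA R) (M : weak_module V).
Local Notation C := R[i].
Local Notation YV := (@voa_Y R V).
Local Notation Y := (@wmod_Y R V M).
Local Notation vac := (voa_vac V).
Implicit Types (a b : V) (u v : M) (n p q : int) (N : nat).

Definition VYlinl := Ylinl (@voa_bilinear R V).
Definition VYlinr := Ylinr (@voa_bilinear R V).
Definition MYlinl := Ylinl (@wmod_bilinear R V M).
Definition MYlinr := Ylinr (@wmod_bilinear R V M).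

Lemma MY0l n u : Y 0 n u = 0. Proof. exact: lin0 (MYlinl n u). Qed.
Lemma MY0r a n : Y a n 0 = 0. Proof. exact: lin0 (MYlinr a n). Qed.

Lemma commutator_formula a b u m n N : (forall i : nat, (N <= i)%N -> YV a i b = 0) ->
  Y a m (Y b n u) - Y b n (Y a m u) =
  \sum_(i < N) binz m i *: Y (YV a i b) (m + n - i%:Z) u.
Proof.
move=> abN; have := wmod_jacobi a b u 0 m n.
rewrite (fsum_single (j := 0%N)); last first.
  by move=> i /negPf i0; rewrite binz0n i0 mulr0 scale0r.
rewrite (fsum_single (j := 0%N)); last first.
  by move=> i /negPf i0; rewrite binz0n i0 mulr0 scale0r.
rewrite binz0 expr0z !mul1r !scale1r !add0r !subr0 => ->.
rewrite (fsum_nat (N := N)) => [|i Ni]; first by under eq_bigr do rewrite add0r.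
by rewrite add0r abN // MY0l scaler0.
Qed.

Lemma VYtrunc a b : exists N, forall i : nat, (N <= i)%N -> YV a i b = 0.
Proof.
have [N h] := vanish_from_ex (@voa_truncated R V) a b 0.
by exists N => i Ni; apply: h Ni _ _; lia.
Qed.

(** The modes of [L(-1) a = a(-2) vac] are those of the derivative of
    [Y(a,z)], on every weak module; this is the Jacobi identity for [a] and the
    vacuum. *)
Lemma module_derivative a n u :
  Y (YV (voa_omega V) 0 a) n u = - (n%:~R *: Y a (n - 1) u).
Proof.
have -> : YV (voa_omega V) 0 a = YV a (-2) vac.
  have [<- _] := voa_creation (YV (voa_omega V) 0 a).
  by rewrite voa_derivative -[-1]/((-1)%:~R) scaleN1r opprK; congr (YV _ _ _).
have := wmod_jacobi a vac u (-2) 0 n.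
rewrite [RHS](fsum_single (j := 0%N)); last first.
  by move=> i /negPf i0; rewrite binz0n i0 scale0r.
rewrite binz0 scale1r addr0 add0r subr0 => <-.
have term i : ((-1) ^+ i * binz (-2) i : C) = i.+1%:R.
  by rewrite binz_neg2 mulrA -expr2 sqrr_sign mul1r.
have sgn : (-1 : C) ^ (-2 : int) = 1.
  by rewrite -[LHS]/(((-1) ^+ 2)^-1) sqrrN expr1n invr1.
have [n0|n0] := leP 1 n.
  rewrite fsum0 => [|i]; last first.
    by rewrite wmod_vacuum ifF ?MY0r ?scaler0 //; apply/eqP; lia.
  rewrite (fsum_single (j := `|n - 1|%N)) => [|i ni]; last first.
    by rewrite wmod_vacuum ifF ?scaler0 //; apply/eqP; lia.
  rewrite wmod_vacuum ifT; last by apply/eqP; lia.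
  rewrite sub0r -mulrA term sgn mul1r; congr (- (_ *: Y a _ _)); last lia.
  by rewrite pmulrn; congr (_%:~R); lia.
rewrite [X in _ - X]fsum0 => [|i]; last first.
  by rewrite wmod_vacuum ifF ?scaler0 //; apply/eqP; lia.
have [n1|n1] := leP 0 n.
  have nE : n = 0 by lia.
  rewrite fsum0 => [|i]; first by rewrite nE scale0r oppr0 addr0.
  by rewrite wmod_vacuum ifF ?MY0r ?scaler0 //; apply/eqP; lia.
rewrite (fsum_single (j := absz (n + 1))) => [|i ni]; last first.
  by rewrite wmod_vacuum ifF ?MY0r ?scaler0 //; apply/eqP; lia.
rewrite wmod_vacuum ifT; last by apply/eqP; lia.
rewrite subr0 term -scaleNr; congr (_ *: Y a _ _); last lia.
by rewrite pmulrn -mulrNz; congr (_%:~R); lia.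
Qed.

(** The commutator formula with [omega] has two nonzero terms here, the modes
    [(L(-1) a)(n + 1) = - (n + 1) a(n)] and [(L(0) a)(n) = k a(n)]. *)
Lemma commutator_L0 k a n u : wt_space k a ->
  vir M 0 (Y a n u) - Y a n (vir M 0 u) = (k - n - 1)%:~R *: Y a n u.
Proof.
move=> ak; have [N aN] := VYtrunc (voa_omega V) a.
rewrite /vir add0r (commutator_formula _ _ _ (N := N.+2)) => [|i Ni]; last first.
  by apply: aN; lia.
have sum2 (F : nat -> M) : (forall i, F i.+2 = 0) ->
    \sum_(i < N.+2) F i = F 0%N + F 1%N.
  move=> F0; rewrite !big_ord_recl big1 ?addr0 // => i _; exact: F0.
rewrite (sum2 (fun i => binz 1 i *: Y (YV (voa_omega V) i a) (1 + n - i%:Z) u));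
  last by move=> i; rewrite (@binz_small _ 1) ?scale0r.
rewrite binz0 (@binz_diag _ 1) !scale1r module_derivative.
have -> : YV (voa_omega V) 1 a = k%:~R *: a by exact: ak.
rewrite (linZ (MYlinl _ _)) subr0 (_ : 1 + n - 1 = n); last by lia.
by rewrite -scaleNr -scalerDl -mulrNz -intrD; congr (_%:~R *: _); lia.
Qed.

End JacobiConsequences.

(** * Zhu's products on V *)

Section ZhuAlgebra.
Context {R : realType} (V : VOA R).
Local Notation C := R[i].
Local Notation YV := (@voa_Y R V).
Local Notation vac := (voa_vac V).
Local Notation omega := (voa_omega V).
Local Notation O := (lin_span (@zhu_generators R V)).
Local Notation resV := (res_mode YV).
Implicit Types (a b c u v x : V) (k l n p q : int) (N : nat).

Definition adjoint_module : weak_module V :=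
  MkWeakModule (voa_bilinear V) (@voa_truncated R V) (@voa_vacuum R V)
    (@voa_jacobi R V).

Lemma wt_space_subspace k : subspace (@wt_space R V k).
Proof.
rewrite /wt_space /eigenspace_of; split=> [|u v /= uk vk|c u /= uk] /=.
- by rewrite (lin0 (VYlinr _ _)) scaler0.
- by rewrite (linD (VYlinr _ _)) uk vk scalerDr.
- by rewrite (linZ (VYlinr _ _)) uk !scalerA mulrC.
Qed.
Local Notation sW := wt_space_subspace.

Lemma wt_graded : direct_sum (@wt_space R V) setT.
Proof. exact: voa_graded. Qed.
Local Notation gW := wt_graded.

Lemma wt_space_mode a b k l n : wt_space k a -> wt_space l b ->
  wt_space (k + l - n - 1) (YV a n b).
Proof.
move=> ak bl; have := @commutator_L0 R V adjoint_module k a n b ak.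
rewrite /vir /= add0r => /eqP; rewrite subr_eq => /eqP h.
have bE : YV omega 1 b = l%:~R *: b by exact: bl.
rewrite /wt_space /eigenspace_of /= h bE (linZ (VYlinr _ _)) -scalerDl -intrD.
by congr (_%:~R *: _); lia.
Qed.

Lemma O_subspace : subspace O.
Proof. exact: lin_span_subspace. Qed.
Local Notation sO := O_subspace.

Lemma resV_linl al p c : linear (fun a => resV al p a c).
Proof. exact: res_mode_linl (voa_bilinear V) (@voa_truncated R V) _ _ _. Qed.
Lemma resV_linr al p a : linear (resV al p a).
Proof. exact: res_mode_linr (voa_bilinear V) (@voa_truncated R V) _ _ _. Qed.

Lemma zhu_circE : @zhu_circ R V = fun a b =>
  graded_ext (@wt_space R V) (fun k a => resV k (-2) a b) a.
Proof.
apply/funext => a; apply/funext => b; apply: eq_fsbigr => k _.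
by apply: eq_fsbigr => i _; rewrite addrC.
Qed.

Lemma zhu_starE : @zhu_star R V = fun a b =>
  graded_ext (@wt_space R V) (fun k a => resV k (-1) a b) a.
Proof.
apply/funext => a; apply/funext => b; apply: eq_fsbigr => k _.
by apply: eq_fsbigr => i _; rewrite addrC.
Qed.

(** Multiplication on the right, written on the left factor: by [zhu_star_skew],
    [zhu_rmul x u] represents the product of [u] and [x]. *)
Definition zhu_rmul x u : V :=
  graded_ext (@wt_space R V) (fun k x => resV (k - 1) (-1) x u) x.

Lemma zhu_circ_linl b : linear (fun a => zhu_circ a b).
Proof.
rewrite zhu_circE.
exact: (graded_ext_linear sW gW (fun k => resV_linl k (-2) b)).
Qed.
Lemma zhu_star_linl b : linear (fun a => zhu_star a b).
Proof.
rewrite zhu_starE.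
exact: (graded_ext_linear sW gW (fun k => resV_linl k (-1) b)).
Qed.
Lemma zhu_rmul_linl u : linear (fun x => zhu_rmul x u).
Proof.
exact: (graded_ext_linear sW gW (fun k => resV_linl (k - 1) (-1) u)).
Qed.

Lemma zhu_circ_homog k a b : wt_space k a -> zhu_circ a b = resV k (-2) a b.
Proof.
move=> ak; rewrite zhu_circE (graded_ext_homog sW gW _ ak) // => l.
exact: resV_linl.
Qed.
Lemma zhu_star_homog k a b : wt_space k a -> zhu_star a b = resV k (-1) a b.
Proof.
move=> ak; rewrite zhu_starE (graded_ext_homog sW gW _ ak) // => l.
exact: resV_linl.
Qed.
Lemma zhu_rmul_homog k x u : wt_space k x -> zhu_rmul x u = resV (k - 1) (-1) x u.
Proof.
move=> xk; rewrite /zhu_rmul (graded_ext_homog sW gW _ xk) // => l.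
exact: resV_linl.
Qed.

Lemma wt_ind (W : set V) : subspace W -> (forall k, @wt_space R V k `<=` W) ->
  forall u, W u.
Proof. exact: (graded_ind gW). Qed.

(** This reduces the linearity of Zhu's products in one argument to the case
    where the other argument is homogeneous. *)
Lemma linear_subspace (E E' : lmodType C) (f : V -> E -> E') :
  (forall y : E, linear (fun a => f a y)) -> subspace [set a | linear (f a)].
Proof.
move=> fl; split=> [c u v|a b fa fb c u v|d a fa c u v] /=.
- by rewrite !(lin0 (fl _)) scaler0 addr0.
- by rewrite !(linD (fl _)) fa fb scalerDr addrACA.
- by rewrite !(linZ (fl _)) fa scalerDr !scalerA mulrC.
Qed.

Lemma zhu_star_linr a : linear (zhu_star a).
Proof.
apply: (wt_ind (linear_subspace zhu_star_linl)) a => k a ak c u v /=.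
by rewrite !(zhu_star_homog _ ak); exact: resV_linr.
Qed.

Lemma zhu_rmul_linr a : linear (zhu_rmul a).
Proof.
apply: (wt_ind (linear_subspace zhu_rmul_linl)) a => k a ak c u v /=.
by rewrite !(zhu_rmul_homog _ ak); exact: resV_linr.
Qed.

Lemma zhu_circ_O a b : O (zhu_circ a b).
Proof. by apply: lin_span_incl; exists (a, b). Qed.

Lemma omega_wt2 : wt_space 2 omega.
Proof.
have [h1 h2] := voa_creation omega.
have := @voa_virasoro R V 0 (-2) vac.
rewrite !add0r (_ : -2 + 1 = -1 :> int) // (h2 1%N) (lin0 (VYlinr _ _)).
by rewrite subr0 h1 /= addr0.
Qed.

Lemma wt_space_translate k v : wt_space k v -> wt_space (k + 1) (YV omega 0 v).
Proof.
move=> vk; have := wt_space_mode 0 omega_wt2 vk; congr (wt_space _ _); lia.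
Qed.

(** Integration by parts: [Y(L(-1) v, z)] is the derivative of [Y(v, z)], and
    the derivative of [(1 + z)^(k+1) z^m] is
    [((k + 1 + m) z^m + m z^(m-1)) (1 + z)^k]. *)
Lemma res_mode_translate k m v c : resV (k + 1) m (YV omega 0 v) c =
  - ((k + 1 + m)%:~R *: resV k m v c) - m%:~R *: resV k (m - 1) v c.
Proof.
have [N h] := vanish_from_ex (@voa_truncated R V) v c (m - 1).
have vN := h N (leqnn _); have vN1 : vanish_from YV v c (m - 1) N.+1 by exact: h.
have vN0 : vanish_from YV v c m N by move=> n mn; apply: vN; lia.
have LN : vanish_from YV (YV omega 0 v) c m N.+1.
  by move=> n mn; rewrite voa_derivative vN1 ?scaler0 ?oppr0 //; lia.
rewrite (res_mode_fin _ LN) (res_mode_fin _ vN1) (res_mode_fin _ vN0) !big_ord_recl !binz0.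
rewrite !scaler_sumr !scale1r !addr0 voa_derivative scalerDr opprD addrCA.
congr (_ + _); rewrite scaler_sumr -!sumrN -big_split /=; apply: eq_bigr => i _.
rewrite voa_derivative /bump add1n.
have -> : m - 1 + i.+1%:Z = m + i%:Z by lia.
have -> : m + i.+1%:Z - 1 = m + i%:Z by lia.
rewrite -!scaleNr !scalerA -scalerDl; congr (_ *: _).
have := @binz_absorb R k i; have := @binz_pascal R k i => P A.
apply: (mulIf (natS_neq0 i)); rewrite P in A *; move: A.
rewrite !intrD -!pmulrn; set b0 := binz k i; set b1 := binz k i.+1.
set x := i.+1%:R; set y : C := k%:~R; set z : C := m%:~R => A.
have -> : (b1 + b0) * - (z + x) * x = - (z + x) * ((b1 + b0) * x) by ring.
have -> : (- (y + 1 + z) * b0 + - z * b1) * x =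
  - (y + 1) * b0 * x - z * ((b1 + b0) * x) by ring.
by rewrite A; ring.
Qed.

(** For [n = 0] this is by induction on [r]: integration by parts applied to
    [L(-1) v], whose weight is [k + 1], lowers the exponent of [z] by one. A
    factor [1 + z] replaces an element by the sum of two, one with a higher power
    of [z], and [n <= r] keeps all exponents of [z] at most [-2]. *)
Lemma O_res_mode k (r n : nat) v c : wt_space k v -> (n <= r)%N ->
  O (resV (k + n%:Z) (-2 - r%:Z) v c).
Proof.
move=> vk; elim: n r => [|n IH] r nr; last first.
  case: r nr => // r nr; rewrite (_ : k + n.+1%:Z = k + n%:Z + 1); last by lia.
  rewrite (res_mode_pascal (@voa_truncated R V)); apply: (subspaceD sO).
    by apply: IH; exact: ltnW.
  by rewrite (_ : _ + 1 = -2 - r%:Z); [exact: IH|lia].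
rewrite addr0; elim: r {nr} k v vk => [|r IH] k v vk.
  by rewrite subr0 -(zhu_circ_homog _ vk); exact: zhu_circ_O.
have := IH _ _ (wt_space_translate vk); rewrite res_mode_translate.
set m : int := -2 - r%:Z; have m0 : m%:~R != 0 :> C by rewrite intr_eq0 /m; lia.
move=> h; have {}h := subspaceD sO h (subspaceZ (k + 1 + m)%:~R sO (IH _ _ vk)).
rewrite -/m addrAC addNr sub0r -scaleNr in h.
have := subspaceZ (- m%:~R)^-1 sO h; rewrite scalerA mulVf ?oppr_eq0 // scale1r.
by rewrite (_ : m - 1 = -2 - r.+1%:Z) // /m; lia.
Qed.

Lemma eventually_forall (P : nat -> nat -> Prop) (T : nat) :
  (forall t, exists N0, forall N, (N0 <= N)%N -> P t N) ->
  exists N0, forall N, (N0 <= N)%N -> forall t, (t < T)%N -> P t N.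
Proof.
move=> h; elim: T => [|T [N0 hN0]]; first by exists 0%N.
have [N1 hN1] := h T; exists (maxn N0 N1) => N; rewrite geq_max => /andP[N0N N1N] t.
by rewrite ltnS leq_eqVlt => /predU1P[->|tT]; [exact: hN1|exact: hN0].
Qed.

(** The coefficient of [w^u] in the product of [(1 + w)^be] with [w^e] times the
    coefficient of [(z - w)^e] in the expansion of [(1 + z)^al] at [z = w]. *)
Lemma binz_convolution al be (e u : nat) :
  \sum_(j < u.+1) binz al (u - j) * binz be j * binz (u - j)%N e =
  (if (e <= u)%N then binz al e * binz (al - e%:Z + be) (u - e) else 0 : C).
Proof.
case: leqP => eu; last by apply: big1 => j _; rewrite binz_small ?mulr0 //; lia.
rewrite -binz_vandermonde mulr_sumr.
rewrite [RHS](big_ord_widen u.+1 (fun j => binz al e * (binz (al - e%:Z) (u - e - j) * binz be j)));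
  last by lia.
rewrite [RHS]big_mkcond; apply: eq_bigr => j _ /=; case: ltnP => ju.
  have -> : (u - j = e + (u - e - j))%N by lia.
  by rewrite mulrAC binz_trinomial -mulrA.
by have := ltn_ord j => ?; rewrite binz_small ?mulr0 //; lia.
Qed.

Lemma res_mode_shift ga p (e : nat) x c N : (e <= N)%N -> vanish_from YV x c (p - e%:Z) N ->
  \sum_(w < N) (if (e <= w)%N then binz ga (w - e) else 0) *: YV x (p - e%:Z + w%:Z) c
  = resV ga p x c.
Proof.
move=> eN xN; have xN' : vanish_from YV x c p (N - e) by move=> n pn; apply: xN; lia.
rewrite (res_mode_fin _ xN').
rewrite -(big_mkord xpredT (fun w => (if (e <= w)%N then binz ga (w - e) else 0)
  *: YV x (p - e%:Z + w%:Z) c)) (big_cat_nat (n := e)) //= big_nat big1 => [|i ie].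
  rewrite add0r -{1}[e]add0n big_addn big_mkord; apply: eq_bigr => i _.
  by rewrite leq_addl addnK; congr (_ *: YV _ _ _); lia.
by rewrite ifF ?scale0r //; lia.
Qed.

(** The commutator of two coefficient extractions, computed from the commutator
    formula by Taylor expansion of [(1 + z)^al z^p] at [z = w]. *)
Lemma res_mode_commutator_in (W : set V) a b c al be p q : subspace W ->
  (forall i e : nat, (e <= i)%N ->
     W (resV (al - e%:Z + be) (p + q - (i - e)%:Z) (YV a i b) c)) ->
  W (resV al p a (resV be q b c) - resV be q b (resV al p a c)).
Proof.
move=> sS H.
have [N1 bc] := vanish_from_ex (@voa_truncated R V) b c q.
have [N2 ac] := vanish_from_ex (@voa_truncated R V) a c p.
have [N3 ab] := @VYtrunc R V a b.
pose N0 := maxn N1 (maxn N2 N3).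
have [N4 abc] := eventually_forall N0 (fun t : nat =>
  vanish_from_ex (@voa_truncated R V) a (YV b (q + t%:Z) c) p).
have [N5 bac] := eventually_forall N0 (fun t : nat =>
  vanish_from_ex (@voa_truncated R V) b (YV a (p + t%:Z) c) q).
have [N6 abi] := eventually_forall N0 (fun i : nat =>
  vanish_from_ex (@voa_truncated R V) (YV a i b) c (p + q - i%:Z)).
pose N := maxn N0 (maxn N4 (maxn N5 N6)).
have [? [? ?]] : (N0 <= N)%N /\ (N4 <= N)%N /\ (N5 <= N)%N by rewrite /N; lia.
have ? : (N6 <= N)%N by rewrite /N; lia.
have bc0 : vanish_from YV b c q N0 by apply: bc; lia.
have {}bc : vanish_from YV b c q N by apply: bc; lia.
have ac0 : vanish_from YV a c p N0 by apply: ac; lia.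
have {}ac : vanish_from YV a c p N by apply: ac; lia.
have ab0 (i : nat) : (N0 <= i)%N -> YV a i b = 0 by move=> Ni; apply: ab; lia.
have {}ab (i : nat) : (N <= i)%N -> YV a i b = 0 by move=> Ni; apply: ab; lia.
have {}abc (t : nat) : vanish_from YV a (YV b (q + t%:Z) c) p N.
  have [tN|Nt] := ltnP t N0; first by apply: abc => //; lia.
  by move=> n _; rewrite (bc0 (q + t%:Z)) ?(lin0 (VYlinr _ _)) //; lia.
have {}bac (t : nat) : vanish_from YV b (YV a (p + t%:Z) c) q N.
  have [tN|Nt] := ltnP t N0; first by apply: bac => //; lia.
  by move=> n _; rewrite (ac0 (p + t%:Z)) ?(lin0 (VYlinr _ _)) //; lia.
have {}abi (i : nat) : vanish_from YV (YV a i b) c (p + q - i%:Z) N.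
  have [tN|Nt] := ltnP i N0; first by apply: abi => //; lia.
  by move=> n _; rewrite ab0 ?(lin0 (VYlinl _ _)) //; lia.
have -> : resV al p a (resV be q b c) - resV be q b (resV al p a c) =
    \sum_(s < N) \sum_(t < N) (binz al s * binz be t) *:
      \sum_(i < N) binz (p + s%:Z) i *: YV (YV a i b) (p + s%:Z + (q + t%:Z) - i%:Z) c.
  rewrite [resV be q b c](res_mode_fin _ bc) [resV al p a c](res_mode_fin _ ac).
  rewrite (lin_sum (resV_linr _ _ _)) (lin_sum (resV_linr be q b)).
  rewrite [X in _ - X](eq_bigr (fun s : 'I_N => \sum_(t < N) (binz al s * binz be t) *:
      YV b (q + t%:Z) (YV a (p + s%:Z) c))) => [|s _]; last first.
    rewrite (linZ (resV_linr _ _ _)) (res_mode_fin _ (bac s)) scaler_sumr.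
    by apply: eq_bigr => t _; rewrite scalerA.
  rewrite [X in X - _](eq_bigr (fun t : 'I_N => \sum_(s < N) (binz al s * binz be t) *:
      YV a (p + s%:Z) (YV b (q + t%:Z) c))) => [|t _]; last first.
    rewrite (linZ (resV_linr _ _ _)) (res_mode_fin _ (abc t)) scaler_sumr.
    by apply: eq_bigr => s _; rewrite scalerA mulrC.
  rewrite exchange_big -sumrB; apply: eq_bigr => s _ /=.
  rewrite -sumrB; apply: eq_bigr => t _; rewrite -scalerBr; congr (_ *: _).
  exact: (@commutator_formula R V adjoint_module _ _ _ _ _ _ ab).
have -> : \sum_(s < N) \sum_(t < N) (binz al s * binz be t) *:
      (\sum_(i < N) binz (p + s%:Z) i *: YV (YV a i b) (p + s%:Z + (q + t%:Z) - i%:Z) c) =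
    \sum_(i < N) \sum_(s < N) \sum_(t < N)
      (binz al s * binz be t * binz (p + s%:Z) i : C) *:
      YV (YV a i b) (p + q - i%:Z + (s + t)%N%:Z) c.
  rewrite [RHS]exchange_big; apply: eq_bigr => s _ /=.
  rewrite [RHS]exchange_big; apply: eq_bigr => t _ /=.
  rewrite scaler_sumr; apply: eq_bigr => i _.
  by rewrite scalerA; congr (_ *: YV _ _ _); lia.
apply: subspace_sum => // i _.
rewrite (@sum_convolution _ _ N N N (fun s t => binz al s * binz be t * binz (p + s%:Z) i)
  (fun w => YV (YV a i b) (p + q - i%:Z + w%:Z) c)) // => [|n Nn]; last first.
  by apply: abi; lia.
(* Vandermonde's identity for [p + (w - j)] separates the Taylor coefficients of
   [z^p], of order [i - e], from those of [(1 + z)^al], of order [e]. *)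
have -> : \sum_(w < N) (\sum_(j < w.+1)
      binz al (w - j) * binz be j * binz (p + (w - j)%N%:Z) i) *:
      YV (YV a i b) (p + q - i%:Z + w%:Z) c =
    \sum_(e < i.+1) (binz p (i - e) * binz al e) *: \sum_(w < N)
      (if (e <= w)%N then binz (al - e%:Z + be) (w - e) else 0 : C) *:
      YV (YV a i b) (p + q - i%:Z + w%:Z) c.
  under [RHS]eq_bigr do rewrite scaler_sumr.
  rewrite [RHS]exchange_big; apply: eq_bigr => w _ /=.
  under [RHS]eq_bigr do rewrite scalerA.
  rewrite -scaler_suml; congr (_ *: _).
  rewrite (eq_bigr (fun j : 'I_w.+1 => \sum_(e < i.+1) binz p (i - e) *
    (binz al (w - j) * binz be j * binz (w - j)%N e))) => [|j _]; last first.
    rewrite -binz_vandermonde mulr_sumr; apply: eq_bigr => e _; ring.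
  rewrite exchange_big; apply: eq_bigr => e _ /=.
  rewrite -mulr_sumr binz_convolution -mulrA; congr (_ * _).
  by case: ifP; rewrite ?mulr0.
apply: subspace_sum => // e _; apply: subspaceZ => //.
have eqi (w : nat) : p + q - i%:Z + w%:Z = p + q - (i - e)%N%:Z - e%:Z + w%:Z.
  by have := ltn_ord e; lia.
under eq_bigr do rewrite eqi.
have ei : (e <= i)%N by rewrite -ltnS.
rewrite res_mode_shift; first exact: H.
  by apply: (leq_trans ei); exact/ltnW.
by move=> n hn; apply: abi; lia.
Qed.

End ZhuAlgebra.

(** * Associativity of Zhu's algebra and centrality of omega *)

Section ZhuProduct.
Context {R : realType} (V : VOA R).
Local Notation C := R[i].
Local Notation YV := (@voa_Y R V).
Local Notation vac := (voa_vac V).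
Local Notation omega := (voa_omega V).
Local Notation O := (lin_span (@zhu_generators R V)).
Local Notation resV := (res_mode YV).
Local Notation sO := (O_subspace V).
Implicit Types (a b c u v x : V) (k l n p q : int) (N : nat).

Lemma O_sym u v : O (u - v) -> O (v - u).
Proof. by move=> /(subspaceZ (-1) sO); rewrite scaleN1r opprB. Qed.

Lemma O_trans v u w : O (u - v) -> O (v - w) -> O (u - w).
Proof. by move=> uv vw; have := subspaceD sO uv vw; rewrite addrA subrK. Qed.

(** Both the left product by [a] and the operator standing for the right product
    by [a] are of the form [res_mode (k - j) (-1) a], with [j = 0] and [j = 1]. *)
Lemma res_mode_O (j : nat) k a y : (j <= 1)%N -> wt_space k a -> O y ->
  O (resV (k - j%:Z) (-1) a y).
Proof.
move=> j1 ak; move: y; apply: lin_span_min.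
  exact: preimage_subspace (resV_linr _ _ _) sO.
move=> _ [[b c] _ <-] /=; rewrite -/(O _).
have sP : subspace [set b | O (resV (k - j%:Z) (-1) a (zhu_circ b c))].
  exact: (preimage_subspace (linear_compf (zhu_circ_linl c) (resV_linr _ _ _)) sO).
apply: (wt_ind sP) b => l b bl /=; rewrite (zhu_circ_homog _ bl).
rewrite -[resV _ _ _ _](subrK (resV l (-2) b (resV (k - j%:Z) (-1) a c))).
apply: (subspaceD sO); last first.
  by rewrite -(zhu_circ_homog _ bl); exact: zhu_circ_O.
apply: (res_mode_commutator_in sO) => i e ei.
(* The weight of [a(i) b] is [k + l - i - 1]. The exponent of [1 + w] exceeds it
   by [1 - j + (i - e)], and that of [w] is [-3 - (i - e)]. *)
have := @O_res_mode R V (k + l - i%:Z - 1) (1 + (i - e)) (1 - j + (i - e))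
  (YV a i b) c (wt_space_mode i ak bl).
have -> : k + l - i%:Z - 1 + (1 - j + (i - e))%N%:Z = k - j%:Z - e%:Z + l by lia.
have -> : -2 - (1 + (i - e))%N%:Z = -1 - 2 - (i - e)%N%:Z by lia.
by apply; lia.
Qed.

Lemma zhu_star_O a y : O y -> O (zhu_star a y).
Proof.
move=> Oy; have sP : subspace [set a | O (zhu_star a y)].
  exact: (preimage_subspace (zhu_star_linl y) sO).
apply: (wt_ind sP) a => k a ak /=; rewrite (zhu_star_homog _ ak) -[k]subr0.
exact: (@res_mode_O 0).
Qed.

Lemma zhu_rmul_O x y : O y -> O (zhu_rmul x y).
Proof.
move=> Oy; have sP : subspace [set x | O (zhu_rmul x y)].
  exact: (preimage_subspace (zhu_rmul_linl y) sO).
apply: (wt_ind sP) x => k x xk /=; rewrite (zhu_rmul_homog _ xk).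
exact: (@res_mode_O 1).
Qed.

Lemma zhu_star_rmul_comm a x c :
  O (zhu_star a (zhu_rmul x c) - zhu_rmul x (zhu_star a c)).
Proof.
have sP : subspace [set a | O (zhu_star a (zhu_rmul x c) - zhu_rmul x (zhu_star a c))].
  exact: (preimage_subspace (linear_subf (zhu_star_linl _)
    (linear_compf (zhu_star_linl c) (zhu_rmul_linr x))) sO).
apply: (wt_ind sP) a => k a ak {sP} /=.
have sP' : subspace [set x | O (zhu_star a (zhu_rmul x c) - zhu_rmul x (zhu_star a c))].
  exact: (preimage_subspace (linear_subf
    (linear_compf (zhu_rmul_linl c) (zhu_star_linr a)) (zhu_rmul_linl _)) sO).
apply: (wt_ind sP') x => l x xl /=.
rewrite !(zhu_rmul_homog _ xl) !(zhu_star_homog _ ak).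
apply: (res_mode_commutator_in sO) => i e ei.
(* Here the exponent of [1 + w] exceeds the weight by [i - e] and that of [w] is
   [-2 - (i - e)], the extreme case of [O_res_mode]. *)
have := @O_res_mode R V (k + l - i%:Z - 1) (i - e) (i - e)
  (YV a i x) c (wt_space_mode i ak xl).
have -> : k + l - i%:Z - 1 + (i - e)%N%:Z = k - e%:Z + (l - 1) by lia.
have -> : -2 - (i - e)%N%:Z = -1 - 1 - (i - e)%N%:Z by lia.
by apply.
Qed.

(** The Jacobi identity for [x] and [b] applied to the vacuum, with the exponents
    chosen so that creation leaves one term on the left. *)
Lemma skew_symmetry b x l : YV b l x =
  (-1) ^ (l + 1) *: \sum_(i \in [set: nat])
    (-1) ^+ i *: YV (YV x (l + i%:Z) b) (-1 - i%:Z) vac.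
Proof.
have := @voa_jacobi R V x b vac l (-1) 0.
rewrite [X in X - _]fsum0 => [|i]; last first.
  have [_ h] := voa_creation b.
  by rewrite add0r h (lin0 (VYlinr _ _)) scaler0.
rewrite (fsum_single (j := 0%N)) => [|i i0]; last first.
  have [_ h] := voa_creation x; case: i i0 => // i _.
  by rewrite (_ : -1 + i.+1%:Z = i%:Z) ?h ?(lin0 (VYlinr _ _)) ?scaler0 //; lia.
have [xvac _] := voa_creation x.
rewrite !addr0 xvac binz0 expr0 !mulr1 sub0r => h.
transitivity ((-1) ^ (l + 1) *: - ((-1) ^ l *: YV b l x)).
  rewrite expfzDr ?oppr_eq0 ?oner_eq0 // expr1z scalerN scalerA mulrAC -expfzMl.
  by rewrite mulrNN mulr1 exp1rz mul1r scaleN1r opprK.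
congr (_ *: _); rewrite h; apply: eq_fsbigr => i _.
rewrite binz_neg (_ : 1 + i%:Z - 1 = i%:Z); last by lia.
by rewrite binz_diag mulr1.
Qed.

(** The vector [L(-1) v + L(0) v] is the product of [v] and the vacuum that
    defines [O]. *)
Lemma translate_O k v : wt_space k v -> O (YV omega 0 v + k%:~R *: v).
Proof.
move=> vk; have := zhu_circ_O v vac; rewrite (zhu_circ_homog _ vk).
have [h1 h2] := voa_creation v.
rewrite /res_mode (fsum_nat (N := 2)) => [|i i2]; last first.
  by rewrite (_ : -2 + i%:Z = (i - 2)%N%:Z) ?h2 ?scaler0 //; lia.
rewrite !big_ord_recl big_ord0 /= !addr0 binz0 scale1r.
have -> : YV v (-2 + (bump 0 0)%:Z) vac = v by exact: h1.
have -> : binz k (bump 0 0) = k%:~R :> C.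
  by rewrite /binz big_ord1 subr0 divr1.
have <- : YV (YV omega 0 v) (-1) vac = YV v (-2) vac.
  by rewrite voa_derivative -scaleNr -mulrNz scale1r.
by have [-> _] := voa_creation (YV omega 0 v).
Qed.

(** Modulo [O], the identity [L(-1) v = - wt(v) v] computes all the coefficients
    of [Y(v,z) vac = exp(z L(-1)) v]. *)
Lemma vacuum_modes k v (j : nat) : wt_space k v ->
  O (YV v (-1 - j%:Z) vac - binz (- k) j *: v).
Proof.
elim: j k v => [|j IH] k v vk.
  have [h _] := voa_creation v; rewrite subr0 h binz0 scale1r subrr.
  exact: (subspace0 sO).
have v1 := translate_O vk.
have j0 := natS_neq0 (R := R) j.
have := IH _ _ (wt_space_translate vk); rewrite voa_derivative -scaleNr -mulrNz.
have -> : - (-1 - j%:Z) = j.+1%:Z by lia.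
have -> : -1 - j%:Z - 1 = -1 - j.+1%:Z by lia.
rewrite -pmulrn => h.
have := subspaceZ (binz (- (k + 1)) j) sO v1; rewrite scalerDr => v2.
have := subspaceD sO h v2; rewrite addrA subrK => {}h.
have := subspaceZ (j.+1%:R^-1) sO h; rewrite scalerDr !scalerA mulVf // scale1r.
suff -> : j.+1%:R^-1 * binz (- (k + 1)) j * k%:~R = - binz (- k) j.+1 :> C.
  by rewrite scaleNr.
apply: (mulIf j0); set b := binz (- (k + 1)) j.
rewrite [LHS]mulrC !mulrA mulfV // mul1r mulNr {}/b.
rewrite (_ : - k = - (k + 1) + 1); last by lia.
rewrite binz_absorb (_ : - (k + 1) + 1 = - k); last by lia.
by rewrite [(- k)%:~R]mulrNz mulNr opprK mulrC.
Qed.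

(** By [skew_symmetry] and [vacuum_modes] the left product is, modulo [O], a
    combination of the [x(w - 1) u] with coefficients
    [(-1)^w sum_j binz k (w - j) binz (w - k - l) j]. Vandermonde's identity and
    the negation of the upper index turn this into [binz (l - 1) w]. *)
Lemma zhu_star_skew u x : O (zhu_star u x - zhu_rmul x u).
Proof.
have sP : subspace [set u | O (zhu_star u x - zhu_rmul x u)].
  exact: (preimage_subspace (linear_subf (zhu_star_linl x) (zhu_rmul_linr x)) sO).
apply: (wt_ind sP) u => k u uk {sP} /=.
have sP' : subspace [set x | O (zhu_star u x - zhu_rmul x u)].
  exact: (preimage_subspace (linear_subf (zhu_star_linr u) (zhu_rmul_linl u)) sO).
apply: (wt_ind sP') x => l x xl /=.
rewrite (zhu_star_homog _ uk) (zhu_rmul_homog _ xl).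
have [N1 h1] := vanish_from_ex (@voa_truncated R V) u x (-1).
have [N2 h2] := vanish_from_ex (@voa_truncated R V) x u (-1).
pose N := maxn N1 N2; have uN := h1 N (leq_maxl _ _).
have xN := h2 N (leq_maxr _ _).
rewrite (res_mode_fin _ uN) (res_mode_fin _ xN).
pose y (n : nat) := YV x (-1 + n%:Z) u.
have y0 (n : nat) : (N <= n)%N -> y n = 0 by move=> Nn; apply: xN; lia.
have uE (i : nat) : YV u (-1 + i%:Z) x =
    (-1) ^+ i *: \sum_(j < N) (-1) ^+ j *: YV (y (i + j)%N) (-1 - j%:Z) vac.
  rewrite skew_symmetry (_ : -1 + i%:Z + 1 = i%:Z); last by lia.
  congr (_ *: _); rewrite (fsum_nat (N := N)) => [|j Nj]; last first.
    by rewrite xN ?(lin0 (VYlinl _ _)) ?scaler0 //; lia.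
  by apply: eq_bigr => j _; rewrite /y; congr (_ *: YV (YV _ _ _) _ _); lia.
have -> : \sum_(i < N) binz (l - 1) i *: YV x (-1 + i%:Z) u =
    \sum_(i < N) \sum_(j < N)
      ((-1) ^+ (i + j) * binz k i * binz ((i + j)%N%:Z - k - l) j) *: y (i + j)%N.
  rewrite (@sum_convolution _ _ N N N (fun i j => (-1) ^+ (i + j) * binz k i *
    binz ((i + j)%N%:Z - k - l) j) y) //.
  apply: eq_bigr => w _; congr (_ *: _).
  rewrite (eq_bigr (fun j : 'I_w.+1 => (-1) ^+ w * (binz k (w - j) *
    binz (w%:Z - k - l) j))) => [|j _]; last first.
    have jw : (j <= w)%N by rewrite -ltnS.
    by rewrite subnK // -[LHS]mulrA.
  rewrite -mulr_sumr binz_vandermonde (_ : k + (w%:Z - k - l) = - (l - w%:Z)).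
    by rewrite binz_neg mulrA -expr2 sqrr_sign mul1r; congr binz; lia.
  lia.
rewrite -sumrB; apply: subspace_sum; first exact: sO.
move=> i _; rewrite uE !scaler_sumr -sumrB; apply: subspace_sum; first exact: sO.
move=> j _; rewrite !scalerA.
have -> : (-1) ^+ (i + j) * binz k i * binz ((i + j)%N%:Z - k - l) j =
  (binz k i * ((-1) ^+ i * (-1) ^+ j)) * binz ((i + j)%N%:Z - k - l) j :> C.
  by rewrite exprD; ring.
rewrite -[X in _ - X]scalerA -scalerBr; apply: (subspaceZ _ sO).
have yk : wt_space (l + k - (i + j)%N%:Z) (y (i + j)%N).
  have := wt_space_mode (-1 + (i + j)%N%:Z) xl uk; congr (wt_space _ _); lia.
have := vacuum_modes j yk.
by rewrite (_ : - (l + k - (i + j)%N%:Z) = (i + j)%N%:Z - k - l) //; lia.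
Qed.

(** The right product by [x] is, modulo [O], an operator of the type treated in
    [res_mode_O]. *)
Lemma zhu_star_Ol x y : O y -> O (zhu_star y x).
Proof.
move=> Oy; have := subspaceD sO (zhu_star_skew y x) (zhu_rmul_O x Oy).
by rewrite subrK.
Qed.

(** Left products commute with the operators [zhu_rmul], which stand for the right
    products. *)
Lemma zhu_starA a b c : O (zhu_star a (zhu_star b c) - zhu_star (zhu_star a b) c).
Proof.
have h1 : O (zhu_star a (zhu_star b c) - zhu_star a (zhu_rmul c b)).
  by rewrite -(linB (zhu_star_linr a)); apply: zhu_star_O; exact: zhu_star_skew.
apply: (O_trans h1); apply: (O_trans (zhu_star_rmul_comm a c b)).
by apply: O_sym; exact: zhu_star_skew.
Qed.

(** Since [omega] has weight 2, the difference of its left product and of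
    [zhu_rmul omega] is the residue of [(1 + z) Y(omega, z)], that is
    [L(-1) + L(0)], and this maps V into [O] by [translate_O]. *)
Lemma zhu_star_omega x : O (zhu_star omega x - zhu_star x omega).
Proof.
apply: O_trans (O_sym (zhu_star_skew x omega)).
rewrite (zhu_star_homog _ (omega_wt2 V)) (zhu_rmul_homog _ (omega_wt2 V)).
have -> : resV 2 (-1) omega x = resV (2 - 1) (-1) omega x + resV (0 + 1) 0 omega x.
  exact: (res_mode_pascal (@voa_truncated R V) 1 (-1) omega x).
rewrite addrAC subrr add0r (res_mode_pascal (@voa_truncated R V)) !res_mode0.
have sP : subspace [set x | O (YV omega 0 x + YV omega (0 + 1) x)].
  apply: (@preimage_subspace _ _ _ (fun x => YV omega 0 x + YV omega (0 + 1) x) _ _ sO).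
  by move=> c u v; rewrite !(VYlinr _ _) scalerDr addrACA.
apply: (wt_ind sP) x => k x xk /=; rewrite add0r.
have -> : YV omega 1 x = k%:~R *: x by exact: xk.
exact: translate_O.
Qed.

End ZhuProduct.

(** * Schur's lemma in countable dimension *)

Section Uncountability.
Context {R : realType}.
Implicit Types (a b x : R).

Lemma subinterval_avoiding (s : seq R) a b : a < b ->
  exists I : R * R, [/\ a <= I.1, I.1 < I.2, I.2 <= b
    & forall x, x \in s -> ~~ (I.1 <= x <= I.2)].
Proof.
move=> ab; elim: s => [|y s [[c d] /= [ac cd db sI]]]; first by exists (a, b).
pose m := (c + d) / 2; have cm : c < m by rewrite /m; lra.
have ltmd : m < d by rewrite /m; lra.
have [ym|my] := ltP y m.
  exists (m, d); split=> //=; first lra.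
  move=> x; rewrite inE => /predU1P[->|/sI]; first by rewrite leNgt ym.
  by apply: contra => /andP[mx ->]; rewrite andbT; lra.
exists (c, (c + m) / 2); split=> //=; [lra|lra|].
move=> x; rewrite inE => /predU1P[->|/sI]; last apply: contra.
  by rewrite negb_and -!ltNge; apply/orP; right; lra.
by move=> /andP[-> xm] /=; lra.
Qed.

(** The reals are uncountable: nested intervals that avoid the fibres one after
    the other meet in a point that belongs to no fibre. *)
Lemma real_infinite_fibre (f : R -> nat) : exists n, infinite_set (f @^-1` [set n]).
Proof.
apply: contrapT => /forallNP fin.
have {fin} avoid n : exists g : R * R -> R * R, forall I, I.1 < I.2 ->
    [/\ I.1 <= (g I).1, (g I).1 < (g I).2, (g I).2 <= I.2
      & forall x, f x = n -> ~~ ((g I).1 <= x <= (g I).2)].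
  have /contrapT/finite_seqP[s sE] := fin n.
  suff /choice : forall I : R * R, exists J : R * R, I.1 < I.2 ->
      [/\ I.1 <= J.1, J.1 < J.2, J.2 <= I.2
        & forall x, f x = n -> ~~ (J.1 <= x <= J.2)].
    by case=> g gP; exists g.
  move=> I.
  have [ltI|] := pselect (I.1 < I.2); last by exists I.
  have [J [J1 J2 J3 sJ]] := subinterval_avoiding s ltI.
  exists J => _; split=> // x xn; apply: sJ.
  by have : (f @^-1` [set n]) x by []; rewrite sE.
have [g gP] := choice avoid.
pose fix I n := if n is n'.+1 then g n' (I n') else ((0, 1) : R * R).
have Ilt n : (I n).1 < (I n).2.
  by elim: n => [|n IH] /=; [exact: ltr01|case: (gP n _ IH)].
have Il m n : (m <= n)%N -> (I m).1 <= (I n).1.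
  elim: n => [|n IH]; first by rewrite leqn0 => /eqP ->.
  rewrite leq_eqVlt => /predU1P[-> //|/IH h]; apply: le_trans h _.
  by case: (gP n _ (Ilt n)).
have Ir m n : (m <= n)%N -> (I n).2 <= (I m).2.
  elim: n => [|n IH]; first by rewrite leqn0 => /eqP ->.
  rewrite leq_eqVlt => /predU1P[-> //|/IH h]; apply: le_trans h.
  by case: (gP n _ (Ilt n)).
have Ilr m n : (I m).1 <= (I n).2.
  apply: le_trans (Il _ _ (leq_maxl m n)) _.
  by apply: le_trans (Ir _ _ (leq_maxr m n)); exact/ltW.
pose S := [set (I n).1 | n in [set: nat]].
have supS : has_sup S.
  split; first by exists (I 0%N).1; exists 0%N.
  by exists (I 0%N).2 => _ [n _ <-].
pose x := sup S.
have xI n : (I n).1 <= x <= (I n).2.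
  apply/andP; split; first by apply: sup_upper_bound => //; exists n.
  by apply: ge_sup; [case: supS|move=> _ [m _ <-]].
have [_ _ _ /(_ x erefl)] := gP (f x) _ (Ilt (f x)).
by have := xI (f x).+1; rewrite /= => ->.
Qed.

Lemma complex_infinite_fibre (f : R[i] -> nat) : exists n : nat, forall m : nat,
  exists c : 'I_m -> R[i], injective c /\ forall i, f (c i) = n.
Proof.
have [n nP] := real_infinite_fibre (fun x => f x%:C%C); exists n => m.
have [B BA mB] := infinite_set_fset m nP.
pose s : seq R := finmap.enum_fset B; have us : uniq s by exact: finmap.fset_uniq.
pose c (i : 'I_m) : R[i] := (nth 0 s i)%:C%C.
have si (i : 'I_m) : (i < size s)%N by exact: leq_trans (ltn_ord i) mB.
exists c; split=> [i j /complexI /eqP|i].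
  by rewrite nth_uniq // => /eqP ?; apply: val_inj.
by apply: BA; exact: mem_nth.
Qed.

End Uncountability.

Section PolynomialAction.
Context {K : fieldType} {E : lmodType K} (T : E -> E).
Hypothesis TL : linear T.
Implicit Types (p q : {poly K}) (x : E).

(** The action of [K[X]] on [E] where [X] acts as [T]. *)
Definition poly_act p x := \sum_(i < size p) p`_i *: iter i T x.

Lemma poly_act_widen p x n : (size p <= n)%N ->
  poly_act p x = \sum_(i < n) p`_i *: iter i T x.
Proof.
move=> pn; rewrite /poly_act (big_ord_widen n (fun i => p`_i *: iter i T x)) //.
rewrite big_mkcond; apply: eq_bigr => i _; case: ltnP => // pi.
by rewrite nth_default ?scale0r.
Qed.

Lemma poly_act_linear x : linear (poly_act ^~ x).
Proof.
move=> c p q; pose n := maxn (size p) (size q).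
have pn : (size p <= n)%N by exact: leq_maxl.
have qn : (size q <= n)%N by exact: leq_maxr.
have cpn : (size (c *: p) <= n)%N by apply: leq_trans (size_scale_leq _ _) pn.
rewrite !(@poly_act_widen _ _ n) //; last first.
  by apply: leq_trans (size_polyD _ _) _; rewrite geq_max cpn.
rewrite scaler_sumr -big_split; apply: eq_bigr => i _ /=.
by rewrite coefD coefZ scalerDl scalerA.
Qed.

Lemma poly_act1 x : poly_act 1 x = x.
Proof. by rewrite /poly_act size_poly1 big_ord1 coef1 scale1r. Qed.

Lemma poly_act_factor c p x :
  poly_act (('X - c%:P) * p) x = T (poly_act p x) - c *: poly_act p x.
Proof.
rewrite mulrBl mulrC mul_polyC (linB (poly_act_linear x)) (linZ (poly_act_linear x)).
congr (_ - _).
have sX : (size (p * 'X)%R <= (size p).+1)%N.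
  have [->|p0] := eqVneq p 0; first by rewrite mul0r size_poly0.
  by rewrite size_mulX.
rewrite (poly_act_widen _ sX) big_ord_recl coefMX eqxx scale0r add0r.
rewrite /poly_act (lin_sum TL); apply: eq_bigr => i _.
by rewrite coefMX /= (linZ TL).
Qed.

Lemma poly_act_prod (s : seq K) x :
  poly_act (\prod_(c <- s) ('X - c%:P)) x = split_op T s x.
Proof.
elim: s => [|c s IH]; first by rewrite big_nil poly_act1.
by rewrite big_cons poly_act_factor IH.
Qed.

End PolynomialAction.

Lemma linear_dependency (K : fieldType) (E : lmodType K) (k : nat) (e : 'I_k -> E)
    (y : 'I_k.+1 -> E) :
  (forall i, exists c : 'I_k -> K, y i = \sum_(j < k) c j *: e j) ->
  exists g : 'I_k.+1 -> K, (exists i, g i != 0) /\ \sum_i g i *: y i = 0.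
Proof.
move=> ye; have [c cE] := choice ye.
pose B : 'M[K]_(k.+1, k) := \matrix_(i, j) c i j.
have : kermx B != 0.
  rewrite -mxrank_eq0 mxrank_ker subn_eq0 -ltnNge ltnS; exact: rank_leq_col.
case/rowV0Pn => g /sub_kermxP gB g0.
exists (g 0); split; first exact/rV0Pn.
under eq_bigr do rewrite cE scaler_sumr.
rewrite exchange_big big1 // => j _ /=.
have /rowP/(_ j) := gB; rewrite !mxE => gBj.
under eq_bigr do rewrite scalerA.
rewrite -scaler_suml (_ : \sum_i _ = 0) ?scale0r // -[RHS]gBj.
by apply: eq_bigr => i _; rewrite mxE.
Qed.

Section Schur.
Context {R : realType} {E : lmodType R[i]} (mul : E -> E -> E).
Local Notation C := R[i].
Hypothesis mulL : forall x, linear (mul x).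
Variable (D : nat -> set E).
Hypotheses (Dfin : forall n, finite_dim (D n)) (Dcover : forall x, exists n, D n x).

(** Schur's lemma in countable dimension, after Dixmier. If [w] were not scalar
    on the minimal left ideal [F], each [w - c] would be invertible on [F]; the
    uncountably many vectors [(w - c)^-1 x] cannot be linearly independent, and
    a dependency between them is a nonzero polynomial in [w] that annihilates
    [x], hence splits into injective factors. *)
Lemma schur_dixmier (w : E) (F : set E) :
  (forall x y, mul w (mul x y) = mul x (mul w y)) -> minimal_left_ideal mul F ->
  exists c : C, forall x, F x -> mul w x = c *: x.
Proof.
move=> wC [[sF mF] F0 Fmin]; pose T := mul w.
have TL : linear T by exact: mulL.
have TcL c : linear (fun v => T v - c *: v) by exact: sub_scale_linear.
have TcF c x : F x -> F (T x - c *: x).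
  move=> Fx; apply: subspaceB => //; [exact: mF|exact: subspaceZ].
have TcM c x y : mul x (T y - c *: y) = T (mul x y) - c *: mul x y.
  by rewrite (linB (mulL x)) (linZ (mulL x)) /T wC.
apply: contrapT => /forallNP noscalar.
have inj c x : F x -> T x - c *: x = 0 -> x = 0.
  move=> Fx x0; pose W := [set v | F v /\ T v - c *: v = 0].
  have sW : subspace W.
    split=> [|u v [Fu u0] [Fv v0]|d u [Fu u0]]; split.
    - exact: subspace0.
    - exact: lin0 (TcL c).
    - exact: subspaceD.
    - by rewrite [LHS](linD (TcL c)) u0 v0 addr0.
    - exact: subspaceZ.
    - by rewrite [LHS](linZ (TcL c)) u0 scaler0.
  have lW : left_ideal mul W.
    split=> // u v [Fv v0]; split; first exact: mF.
    by rewrite -TcM v0 (lin0 (mulL u)).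
  have [W0|WF] := Fmin W lW (fun v => @proj1 _ _).
    by have : [set 0] x by rewrite -W0.
  case: (noscalar c) => v; rewrite -WF => -[_ /eqP].
  by rewrite subr_eq0 => /eqP.
have surj c x : F x -> exists2 y, F y & T y - c *: y = x.
  pose W := [set v | exists2 y, F y & T y - c *: y = v].
  have sW : subspace W.
    split=> [|u v [y Fy <-] [z Fz <-]|d u [y Fy <-]].
    - by exists 0; [exact: subspace0|exact: lin0 (TcL c)].
    - by exists (y + z); [exact: subspaceD|exact: linD (TcL c) y z].
    - by exists (d *: y); [exact: subspaceZ|exact: linZ (TcL c) d y].
  have lW : left_ideal mul W.
    split=> // u v [y Fy <-]; exists (mul u y); first exact: mF.
    by rewrite -TcM.
  have WF : W `<=` F by move=> v [y Fy <-]; exact: TcF.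
  move=> Fx; have [W0|WE] := Fmin W lW WF; last by have : W x by rewrite WE.
  case: F0; apply/seteqP; split=> [y Fy|y ->]; last exact: subspace0.
  apply: (inj c y Fy); have : [set 0] (T y - c *: y) by rewrite -W0; exists y.
  exact.
have [x [Fx x0]] : exists x, F x /\ x <> 0.
  apply: contrapT => /forallNP h; apply: F0; apply/seteqP.
  split=> [y Fy|y ->]; last exact: subspace0.
  by apply: contrapT => y0; exact: (h y).
have [y yP] := choice (fun c => let: ex_intro2 y Fy yx := surj c x Fx in
  ex_intro (fun y => F y /\ T y - c *: y = x) y (conj Fy yx)).
have [f fP] := choice (fun c => Dcover (y c)).
have [n dn] := complex_infinite_fibre f.
have [k [e eP]] := Dfin n.
have [c [cinj cn]] := dn k.+1.
have [g [[i0 gi0] g0]] : exists g : 'I_k.+1 -> C, (exists i, g i != 0) /\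
    \sum_i g i *: y (c i) = 0.
  by apply: (linear_dependency (e := e)) => i; apply: eP; rewrite -(cn i).
pose P i := \prod_(j | j != i) ('X - (c j)%:P).
pose Q := \sum_i g i *: P i.
pose s := [seq c j | j <- enum 'I_k.+1].
have Pkill i z : poly_act T (P i) z = split_op T [seq c j | j <- enum (predC1 i)] z.
  by rewrite -(poly_act_prod TL) big_map big_enum.
have Px i : poly_act T (P i) x = split_op T s (y (c i)).
  have [_ <-] := yP (c i); rewrite Pkill (split_op_factor TL) -Pkill -(poly_act_factor TL).
  rewrite -(poly_act_prod TL); congr (poly_act T _ _).
  by rewrite big_map big_enum [RHS](bigD1 i).
have Qx : poly_act T Q x = 0.
  transitivity (split_op T s (\sum_i g i *: y (c i))); last by rewrite g0 split_op0.
  rewrite /Q (lin_sum (poly_act_linear T x)).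
  rewrite (lin_sum (split_op_linear TL s)); apply: eq_bigr => i _.
  by rewrite (linZ (poly_act_linear T x)) (linZ (split_op_linear TL s)) Px.
have Q0 : Q != 0.
  apply: contraNneq gi0 => Q0; have : Q.[c i0] = 0 by rewrite Q0 horner0.
  rewrite horner_sum (bigD1 i0) //= big1 => [|i ii0]; last first.
    rewrite hornerZ horner_prod (bigD1 i0) 1?eq_sym //= hornerXsubC subrr.
    by rewrite mul0r mulr0.
  rewrite addr0 hornerZ horner_prod => /eqP; rewrite mulf_eq0 => /orP[//|].
  rewrite prodf_seq_eq0 => /hasP[j _] /andP[ji0]; rewrite hornerXsubC subr_eq0.
  by move=> /eqP/cinj ij; rewrite ij eqxx in ji0.
have [r Qr] := closed_field_poly_normal Q.
have kF t v : F v -> F (split_op T t v) by apply: split_op_stable => // z; exact: mF.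
have : split_op T r x = 0.
  have := Qx; rewrite Qr (linZ (poly_act_linear T x)) (poly_act_prod TL) => /eqP.
  by rewrite scaler_eq0 lead_coef_eq0 (negPf Q0) => /eqP.
elim: r {Qr} => //= d r IH; move=> rx.
by apply: IH; apply: (inj d) => //; exact: kF.
Qed.

End Schur.

(** * The class of omega in a semisimple Zhu algebra *)

Section FiniteDimension.
Context {K : nzRingType} {E : lmodType K}.
Implicit Types W : set E.

Lemma finite_dim0 : finite_dim [set (0 : E)].
Proof.
by exists 0%N, (fun=> 0) => _ ->; exists (fun=> 0); rewrite big_ord0.
Qed.

Lemma finite_dimD W1 W2 : finite_dim W1 -> finite_dim W2 ->
  finite_dim [set u | exists u1 u2, [/\ W1 u1, W2 u2 & u = u1 + u2]].
Proof.
move=> [k1 [e1 h1]] [k2 [e2 h2]].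
exists (k1 + k2)%N, (fun i : 'I_(k1 + k2) =>
  match fintype.split i with inl j => e1 j | inr j => e2 j end).
move=> _ [_ [_ [/h1[c1 ->] /h2[c2 ->] ->]]].
exists (fun i : 'I_(k1 + k2) =>
  match fintype.split i with inl j => c1 j | inr j => c2 j end).
rewrite big_split_ord; congr (_ + _); apply: eq_bigr => i _.
  by rewrite (unsplitK (inl i)).
by rewrite (unsplitK (inr i)).
Qed.

End FiniteDimension.

Section ZhuQuotient.
Context {R : realType} (V : VOA R).
Local Notation C := R[i].
Local Notation vac := (voa_vac V).
Local Notation omega := (voa_omega V).
Local Notation O := (lin_span (@zhu_generators R V)).
Local Notation A := (zhu_algebra V).
Local Notation proj := (quot_proj (@zhu_generators R V)).
Implicit Types (a b c : V) (x y z : A).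

Lemma proj_linear : linear proj.
Proof. by move=> c a b; rewrite quot_projD quot_projZ. Qed.

Lemma proj_eq a b : O (a - b) -> proj a = proj b.
Proof. by move/quot_projP. Qed.

Lemma zhu_mul_proj a b : zhu_mul V (proj a) (proj b) = proj (zhu_star a b).
Proof.
have ha : O (repr (proj a) - a) by apply/quot_projP; rewrite quot_reprK.
have hb : O (repr (proj b) - b) by apply/quot_projP; rewrite quot_reprK.
apply: proj_eq; apply: (@O_trans _ _ (zhu_star (repr (proj a)) b)).
  by rewrite -(linB (zhu_star_linr _)); exact: zhu_star_O.
by rewrite -(linB (zhu_star_linl b)); exact: zhu_star_Ol.
Qed.

Lemma zhu_mul_linear x : linear (zhu_mul V x).
Proof.
rewrite -[x]quot_reprK => c y z; rewrite -[y]quot_reprK -[z]quot_reprK.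
by rewrite -proj_linear !zhu_mul_proj (zhu_star_linr _) proj_linear.
Qed.

Lemma zhu_mul_omega x y :
  zhu_mul V (proj omega) (zhu_mul V x y) = zhu_mul V x (zhu_mul V (proj omega) y).
Proof.
rewrite -[x]quot_reprK -[y]quot_reprK !zhu_mul_proj; apply: proj_eq.
set a := repr x; set b := repr y.
apply: (O_trans (zhu_starA omega a b)); apply: (@O_trans _ _ (zhu_star (zhu_star a omega) b)).
  rewrite -(linB (zhu_star_linl b)); apply: zhu_star_Ol; exact: zhu_star_omega.
by apply: O_sym; exact: zhu_starA.
Qed.

(** These subspaces are finite-dimensional, and there are countably many of them:
    they show that A(V) has countable dimension. *)
Definition weight_part (r : seq int) : set A :=
  [set x | exists v : int -> V, (forall k, wt_space k (v k)) /\
     x = \sum_(k <- r) proj (v k)].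

Lemma weight_part_finite r : finite_dim (weight_part r).
Proof.
elim: r => [|k r IH].
  have [m [e h]] := @finite_dim0 C A; exists m, e => x [v [_ ->]].
  by apply: h; rewrite big_nil.
have [m [e h]] := @voa_finite_dim R V k.
have Wk : finite_dim [set proj v | v in wt_space k].
  exists m, (fun j => proj (e j)) => _ [v /h[c ->] <-]; exists c.
  rewrite (lin_sum proj_linear); apply: eq_bigr => j _.
  exact: linZ proj_linear _ _.
have [n [f g]] := finite_dimD Wk IH; exists n, f => x [v [vk ->]]; apply: g.
exists (proj (v k)), (\sum_(j <- r) proj (v j)); rewrite big_cons.
by split=> //; [exists (v k)|exists v].
Qed.

Lemma weight_part_cover x : exists r, weight_part r x.
Proof.
have [r [_ _ xr]] := components_sum (wt_graded V) (repr x).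
exists r, (components (@wt_space R V) (repr x)).
split=> [k|]; first exact: components_in (wt_graded V) _ _.
by rewrite -[LHS]quot_reprK {1}xr (lin_sum proj_linear).
Qed.

Lemma omega_scalar F : minimal_left_ideal (zhu_mul V) F ->
  exists d : C, forall x, F x -> zhu_mul V (proj omega) x = d *: x.
Proof.
apply: (schur_dixmier zhu_mul_linear
  (D := fun n => weight_part (odflt [::] (unpickle n)))).
- by move=> n; exact: weight_part_finite.
- by move=> x; have [r rx] := weight_part_cover x; exists (pickle r); rewrite pickleK.
- exact: zhu_mul_omega.
Qed.

(** The pairs consist of the components of the unit along minimal left ideals and
    of the scalars by which [omega] acts on these. The product of the [omega - c]
    over these scalars annihilates the unit, hence every module over A(V). *)
Lemma semisimple_unit : semisimple (zhu_mul V) ->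
  exists r : seq (C * V), O (vac - \sum_(p <- r) p.2) /\
    forall p, p \in r -> O (zhu_star omega p.2 - p.1 *: p.2).
Proof.
move=> [I [F [Fmin [_ FA]]]].
have : sum_space F (proj vac) by rewrite FA.
case=> f /decomposesP[Ff [s [_ _ sE]]].
have [c cP] := choice (fun i => omega_scalar (Fmin i)).
exists [seq (c i, repr (f i)) | i <- s]; split.
  apply/quot_projP; rewrite big_map (lin_sum proj_linear) sE.
  by apply: eq_bigr => i _; rewrite quot_reprK.
move=> _ /mapP[i _ ->] /=; apply/quot_projP.
rewrite (linZ proj_linear) -zhu_mul_proj quot_reprK; exact: cP.
Qed.

End ZhuQuotient.

(** * Zero modes modulo a submodule *)

Section ZeroModes.
Context {R : realType} (V : VOA R) (M : weak_module V).
Local Notation C := R[i].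
Local Notation YV := (@voa_Y R V).
Local Notation Y := (@wmod_Y R V M).
Local Notation vac := (voa_vac V).
Local Notation omega := (voa_omega V).
Local Notation O := (lin_span (@zhu_generators R V)).
Local Notation resV := (res_mode YV).
Local Notation sW := (@wt_space_subspace R V).
Local Notation gW := (wt_graded V).
Implicit Types (a b c : V) (u v : M) (k l n : int).

(** Zhu's [o(a)], the mode of [a] that preserves degrees. *)
Definition zero_mode a u : M :=
  graded_ext (@wt_space R V) (fun k a => Y a (k - 1) u) a.

Lemma zero_mode_linear u : linear (fun a => zero_mode a u).
Proof. exact: (graded_ext_linear sW gW (fun k => MYlinl (k - 1) u)). Qed.

Lemma zero_mode_homog k a u : wt_space k a -> zero_mode a u = Y a (k - 1) u.
Proof.
by move=> ak; rewrite /zero_mode (graded_ext_homog sW gW _ ak) // => l; exact: MYlinl.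
Qed.

Lemma lin_res_mode (E : lmodType C) (f : V -> E) al p a b : linear f ->
  f (resV al p a b) = \sum_(i \in [set: nat]) binz al i *: f (YV a (p + i%:Z) b).
Proof.
move=> fL; have [N h] := vanish_from_ex (@voa_truncated R V) a b p.
have abN := h N (leqnn N); rewrite (res_mode_fin _ abN) (lin_sum fL) (fsum_nat (N := N)).
  by apply: eq_bigr => i _; rewrite (linZ fL).
by move=> i Ni; rewrite abN ?(lin0 fL) ?scaler0 //; lia.
Qed.

Lemma zhu_circ_linr a : linear (@zhu_circ R V a).
Proof.
apply: (wt_ind (linear_subspace (@zhu_circ_linl R V))) a => k a ak c u v /=.
by rewrite !(zhu_circ_homog _ ak); exact: resV_linr.
Qed.

Variables (N : set M) (u : M).
Hypotheses (sN : subspace N) (NY : forall a n v, N v -> N (Y a n v)).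
Hypothesis lowering : forall k a n, wt_space k a -> k - n - 1 < 0 -> N (Y a n u).

(** Modulo a submodule that contains everything below [u], the zero modes make
    [u] generate a module over [A(V)]: the generators of [O(V)] act by 0 and the
    product of [A(V)] acts by composition. Both are instances of the Jacobi
    identity. *)
Lemma zero_mode_O a : O a -> N (zero_mode a u).
Proof.
move: a; apply: lin_span_min; first exact: preimage_subspace (zero_mode_linear u) sN.
move=> _ [[b c] _ <-] /=.
have sP : subspace [set b | N (zero_mode (zhu_circ b c) u)].
  exact: (preimage_subspace (linear_compf (zhu_circ_linl c) (zero_mode_linear u)) sN).
apply: (wt_ind sP) b => k b bk {sP} /=.
have sP : subspace [set c | N (zero_mode (zhu_circ b c) u)].
  exact: (preimage_subspace (linear_compf (zhu_circ_linr b) (zero_mode_linear u)) sN).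
apply: (wt_ind sP) c => l c cl /=; rewrite (zhu_circ_homog _ bk).
rewrite (lin_res_mode _ _ _ _ (zero_mode_linear u)).
have -> : \sum_(i \in [set: nat]) binz k i *: zero_mode (YV b (-2 + i%:Z) c) u =
    \sum_(i \in [set: nat]) binz k i *: Y (YV b (-2 + i%:Z) c) (k + l - i%:Z) u.
  apply: eq_fsbigr => i _; congr (_ *: _).
  rewrite (zero_mode_homog _ (wt_space_mode (-2 + i%:Z) bk cl)).
  by congr (Y _ _ _); lia.
rewrite -(wmod_jacobi b c u (-2) k l); apply: subspaceB => //.
  apply: fsum_in => // i; apply: subspaceZ => //; apply: NY.
  by apply: (lowering cl); lia.
apply: fsum_in => // i; apply: subspaceZ => //; apply: NY.
by apply: (lowering bk); lia.
Qed.

Lemma zero_mode_star a b :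
  N (zero_mode (zhu_star a b) u - zero_mode a (zero_mode b u)).
Proof.
have sP : subspace [set a | N (zero_mode (zhu_star a b) u - zero_mode a (zero_mode b u))].
  exact: (preimage_subspace (linear_subf
    (linear_compf (zhu_star_linl b) (zero_mode_linear u)) (zero_mode_linear _)) sN).
apply: (wt_ind sP) a => k a ak {sP} /=; rewrite (zero_mode_homog _ ak).
have sP : subspace [set b | N (zero_mode (zhu_star a b) u - Y a (k - 1) (zero_mode b u))].
  exact: (preimage_subspace (linear_subf
    (linear_compf (zhu_star_linr a) (zero_mode_linear u))
    (linear_compf (zero_mode_linear u) (MYlinr a (k - 1)))) sN).
apply: (wt_ind sP) b => l b bl /=.
rewrite (zhu_star_homog _ ak) (zero_mode_homog _ bl) (lin_res_mode _ _ _ _ (zero_mode_linear u)).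
have -> : \sum_(i \in [set: nat]) binz k i *: zero_mode (YV a (-1 + i%:Z) b) u =
    \sum_(i \in [set: nat]) binz k i *: Y (YV a (-1 + i%:Z) b) (k + (l - 1) - i%:Z) u.
  apply: eq_fsbigr => i _; congr (_ *: _).
  rewrite (zero_mode_homog _ (wt_space_mode (-1 + i%:Z) ak bl)).
  by congr (Y _ _ _); lia.
rewrite -(wmod_jacobi a b u (-1) k (l - 1)) addrAC; apply: subspaceB => //; last first.
  apply: fsum_in => // i; apply: subspaceZ => //; apply: NY.
  by apply: (lowering ak); lia.
have [N0 h] := vanish_from_ex (@wmod_truncated R V M) b u (l - 1).
have bN := h N0.+1 (leqnSn _).
rewrite (fsum_nat (N := N0.+1)) => [|i Ni]; last first.
  by rewrite bN ?MY0r ?scaler0 //; lia.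
rewrite big_ord_recl /= expr0 binz0 mul1r scale1r addr0.
rewrite [-1 + k]addrC !addr0.
rewrite addrAC subrr add0r; apply: subspace_sum => // i _; apply: subspaceZ => //.
by apply: NY; apply: (lowering bl); rewrite /bump; lia.
Qed.

Lemma split_op_in s d v : d \in s -> N (vir M 0 v - d *: v) ->
  N (split_op (vir M 0) s v).
Proof.
have TL : linear (vir M 0) by exact: MYlinr.
have NT w : N w -> N (vir M 0 w) by exact: NY.
elim: s => //= e s IH; rewrite inE => /predU1P[-> Nv|/IH{}IH /IH Ns].
  by rewrite -(split_op_factor TL); exact: split_op_stable.
by apply: subspaceB => //; [exact: NT|exact: subspaceZ].
Qed.

Lemma vac_wt : wt_space 0 vac.
Proof.
have [_ h] := voa_creation omega.
by rewrite /wt_space /eigenspace_of /= (h 1%N) scale0r.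
Qed.

(** As [u] is the image of itself under the zero mode of the vacuum, it is modulo
    [N] the sum of its images under the zero modes of the [p.2], and [L(0)], the
    zero mode of [omega], acts on each of these by the scalar [p.1]. *)
Lemma split_op_top (r : seq (C * V)) : O (vac - \sum_(p <- r) p.2) ->
  (forall p, p \in r -> O (zhu_star omega p.2 - p.1 *: p.2)) ->
  N (split_op (vir M 0) [seq p.1 | p <- r] u).
Proof.
have TL : linear (vir M 0) by exact: MYlinr.
have Nk t w : N w -> N (split_op (vir M 0) t w).
  by apply: split_op_stable => // v; exact: NY.
move=> vr rP; have := zero_mode_O vr; rewrite (linB (zero_mode_linear u)).
rewrite (zero_mode_homog _ vac_wt) wmod_vacuum sub0r eqxx (lin_sum (zero_mode_linear u)).
move=> /(Nk [seq p.1 | p <- r]); rewrite (linB (split_op_linear TL _)).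
rewrite (lin_sum (split_op_linear TL _)) => h; rewrite -[split_op _ _ u](subrK
  (\sum_(p <- r) split_op (vir M 0) [seq q.1 | q <- r] (zero_mode p.2 u))).
apply: subspaceD => //; apply: subspace_sum => // p pr.
apply: (@split_op_in _ p.1); first exact: map_f.
have h1 := zero_mode_star omega p.2.
have h2 := zero_mode_O (rP p pr).
rewrite (linB (zero_mode_linear u)) (linZ (zero_mode_linear u)) in h2.
rewrite (zero_mode_homog _ (omega_wt2 V)) in h1.
have := subspaceB sN h2 h1; rewrite opprB addrC addrA subrK.
by rewrite /vir add0r.
Qed.

End ZeroModes.

(** * The eigenvalues of L(0) on an admissible module *)

Section WeakModuleEigenspaces.
Context {R : realType} (V : VOA R) (M : weak_module V).
Local Notation C := R[i].
Local Notation Y := (@wmod_Y R V M).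
Local Notation L0 := (vir M 0).
Implicit Types (a b : V) (u v : M) (k l n : int).

Lemma L0_linear : linear L0.
Proof. exact: MYlinr. Qed.

Lemma gen_L0_mode k a n c u : wt_space k a -> gen_L0_eigenspace M c u ->
  gen_L0_eigenspace M (c + (k - n - 1)%:~R) (Y a n u).
Proof.
move=> ak [j uj]; exists j; elim: j u uj => [|j IH] u.
  by move=> /= ->; exact: MY0r.
rewrite !iterSr => /IH; rewrite (linB (MYlinr _ _)) (linZ (MYlinr _ _)).
rewrite (_ : L0 (Y a n u) - _ = Y a n (L0 u) - c *: Y a n u) //.
rewrite -[L0 (Y a n u)](subrK (Y a n (L0 u))) (commutator_L0 n u ak) scalerDl.
by rewrite [c *: _ + _]addrC opprD addrA [_ + Y a n (L0 u)]addrC addrK.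
Qed.

Lemma L0_mode k a n c u : wt_space k a -> L0_eigenspace M c u ->
  L0_eigenspace M (c + (k - n - 1)%:~R) (Y a n u).
Proof.
rewrite /L0_eigenspace /eigenspace_of /= => ak uc.
rewrite -[L0 (Y a n u)](subrK (Y a n (L0 u))) (commutator_L0 n u ak) uc.
by rewrite (linZ (MYlinr _ _)) scalerDl addrC.
Qed.

Lemma gen_L0_subspace c : subspace (gen_L0_eigenspace M c).
Proof. exact: (gen_eigenspace_subspace L0_linear c). Qed.

Lemma L0_eigen_gen c : L0_eigenspace M c `<=` gen_L0_eigenspace M c.
Proof. by move=> u uc; exists 1%N => /=; rewrite uc subrr. Qed.

Lemma L0_eigenspace_subspace c : subspace (L0_eigenspace M c).
Proof.
rewrite /L0_eigenspace /eigenspace_of; split=> [|u v /= uk vk|d u /= uk] /=.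
- by rewrite (lin0 L0_linear) scaler0.
- by rewrite (linD L0_linear) uk vk scalerDr.
- by rewrite (linZ L0_linear) uk !scalerA mulrC.
Qed.

Lemma gen_L0_eigenvector c u : gen_L0_eigenspace M c u -> u <> 0 ->
  exists v, L0_eigenspace M c v /\ v <> 0.
Proof.
move=> [j uj]; elim: j u uj => [|j IH] u; first by move=> /= ->.
rewrite iterSr; have [/eqP uE _ u0|nu] := pselect (L0 u - c *: u = 0).
  by exists u; split=> //; apply/eqP; rewrite -subr_eq0.
by move=> /IH h _; exact: h.
Qed.

End WeakModuleEigenspaces.

Section AdmissibleEigenvalues.
Context {R : realType} (V : VOA R) (M : admissible_module V).
Local Notation C := R[i].
Local Notation Y := (@wmod_Y R V M).
Local Notation L0 := (vir M 0).
Local Notation deg := (@degree_op R V M).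
Local Notation Mn := (@amod_deg R V M).
Local Notation O := (lin_span (@zhu_generators R V)).
Implicit Types (a b : V) (u v : M) (k l : int) (n m : nat).

Let sM := @amod_deg_subspace R V M.
Let gM := @amod_deg_direct R V M.

Lemma scale_linear n : linear (fun u : M => (n%:R : C) *: u).
Proof. by move=> c u v; rewrite scalerDr !scalerA mulrC. Qed.

Lemma degree_op_linear : linear deg.
Proof. exact: (graded_ext_linear sM gM scale_linear). Qed.

Lemma degree_op_homog n u : Mn n u -> deg u = n%:R *: u.
Proof. exact: (graded_ext_homog sM gM scale_linear). Qed.

Lemma amod_ind (W : set M) : subspace W -> (forall n, Mn n `<=` W) -> forall u, W u.
Proof. exact: (graded_ind gM). Qed.

Lemma degree_op_mode k a (j : int) u : wt_space k a ->
  deg (Y a j u) - Y a j (deg u) = (k - j - 1)%:~R *: Y a j u.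
Proof.
move=> ak; move: u; apply: amod_ind.
  apply: equalizer_subspace; last exact/linear_scalef/MYlinr.
  apply: linear_subf; first exact: linear_compf (MYlinr a j) degree_op_linear.
  exact: linear_compf degree_op_linear (MYlinr a j).
move=> m u um /=; rewrite (degree_op_homog um) (linZ (MYlinr _ _)).
have := amod_deg_shift ak j um; case E : (k + m%:Z - j - 1) => [n|n] /=.
  move=> /degree_op_homog ->; rewrite -scalerBl; congr (_ *: _).
  by rewrite !pmulrn -intrB -E; congr (_%:~R); lia.
by move=> ->; rewrite (lin0 degree_op_linear) !scaler0 subr0.
Qed.

(** Modes shift the eigenvalues of L(0) and of [d] by the same amount. Hence this
    operator commutes with all modes and its torsion spaces are submodules. *)
Definition defect u : M := L0 u - deg u.

Lemma defect_linear : linear defect.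
Proof.
move=> c u v; rewrite /defect (@L0_linear R V M) degree_op_linear scalerBr.
by rewrite opprD addrACA.
Qed.

Lemma defect_mode a (j : int) u : Y a j (defect u) = defect (Y a j u).
Proof.
move: a; apply: wt_ind.
  apply: equalizer_subspace; first exact: MYlinl.
  exact: linear_compf (MYlinl j u) defect_linear.
move=> k a ak /=; rewrite /defect (linB (MYlinr _ _)).
have := commutator_L0 j u ak; rewrite -(degree_op_mode _ _ ak) => /eqP.
rewrite subr_eq => /eqP ->.
have aux (x y z : M) : x - z = y - z + x - y.
  by rewrite addrAC [y - z]addrC addrK addrC.
exact: aux.
Qed.

Lemma L0_degree n u : Mn n u -> Mn n (L0 u).
Proof.
move=> un; have := amod_deg_shift (omega_wt2 V) (0 + 1) un.
by rewrite (_ : 2 + n%:Z - (0 + 1) - 1 = n%:Z) //; lia.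
Qed.

Lemma split_op_L0_degree n u (s : seq C) : Mn n u ->
  split_op L0 s u = split_op defect [seq c - n%:R | c <- s] u.
Proof.
move=> un; have kn t : Mn n (split_op L0 t u).
  by apply: split_op_stable => // v; exact: L0_degree.
elim: s => //= c s IH; rewrite -IH /defect (degree_op_homog (kn s)).
by rewrite scalerBl opprB addrA subrK.
Qed.

Lemma split_op_defect_degree n u (s : seq C) : Mn n u ->
  split_op defect s u = split_op L0 [seq c + n%:R | c <- s] u.
Proof.
move=> un; rewrite (split_op_L0_degree _ un) -map_comp; congr split_op.
by rewrite -[LHS]map_id; apply: eq_map => c /=; rewrite addrK.
Qed.

Variable r : seq (C * V).
Hypothesis r_unit : O (voa_vac V - \sum_(p <- r) p.2).
Hypothesis r_scalar :
  forall p, p \in r -> O (zhu_star (voa_omega V) p.2 - p.1 *: p.2).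

Definition defect_values n : set C :=
  [set c | exists p j, [/\ p \in r, (j < n)%N & c = p.1 - j%:R]].

(** The vectors on which [L(0) - d] has the expected eigenvalues form a
    submodule; if it contains everything in degree less than [n], then the
    semisimplicity of [A(V)] bounds the eigenvalues of [L(0)] in degree [n]. *)
Lemma degree_torsion n u : Mn n u -> torsion defect (defect_values n.+1) u.
Proof.
elim/ltn_ind: n u => n IH u un.
pose N := torsion defect (defect_values n).
have lowN m v : (m < n)%N -> Mn m v -> N v.
  move=> mn /IH h; apply: torsionS (h mn) => c [p [j [pr jm ->]]].
  by exists p, j; split=> //; apply: leq_trans jm mn.
have sN : subspace N by exact: torsion_subspace defect_linear _.
have NY a j v : N v -> N (Y a j v).
  move=> Nv; apply: (torsion_stable (D := Y a j)) => //; first exact: MYlinr.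
  by move=> w; exact: defect_mode.
have low k a (j : int) : wt_space k a -> k - j - 1 < 0 -> N (Y a j u).
  move=> ak kj; have := amod_deg_shift ak j un.
  have kn : k + n%:Z - j - 1 < n%:Z by lia.
  case: (k + n%:Z - j - 1) kn => m /=; first by move=> mn; exact: lowN.
  by move=> _ ->; exact: subspace0.
have [s sn] := split_op_top sN NY low r_unit r_scalar.
rewrite (split_op_L0_degree _ un) -split_op_cat => ks.
exists (s ++ [seq c - n%:R | c <- [seq p.1 | p <- r]]) => // c.
rewrite mem_cat => /orP[/sn[p [j [pr jn ->]]]|].
  by exists p, j; split=> //; exact: ltnW.
by move=> /mapP[_ /mapP[p pr ->] ->]; exists p, n.
Qed.

Definition L0_values : set C := [set c | exists p m, p \in r /\ c = p.1 + m%:R].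

Lemma amod_torsion u : torsion L0 L0_values u.
Proof.
move: u; apply: amod_ind; first exact: torsion_subspace (@L0_linear R V M) _.
move=> n u un; have [s sn] := degree_torsion un.
rewrite (split_op_defect_degree _ un) => ks.
exists [seq c + n%:R | c <- s] => // _ /mapP[c /sn[p [j [pr jn ->]]] ->].
by exists p, (n - j)%N; split=> //; rewrite natrB ?addrA ?[_ + n%:R - _]addrAC // -ltnS.
Qed.

End AdmissibleEigenvalues.

(** * Submodules and quotients of weak modules *)

Section SubspaceType.
Context {K : nzRingType} {E : lmodType K}.

Fact lin_spanb_scale_closed (S : set E) (c : K) :
  {in lin_spanb S, forall u, c *: u \in lin_spanb S}.
Proof.
move=> u /asboolP uS; apply/asboolP.
exact: subspaceZ (lin_span_subspace S) uS.
Qed.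

HB.instance Definition _ (S : set E) :=
  GRing.isScaleClosed.Build K E (lin_spanb S) (@lin_spanb_scale_closed S).

(** The type is indexed by a spanning set: its module structure can then be
    inferred without a proof that the set is a subspace. *)
Definition sub_span (S : set E) : Type := {u : E | u \in (lin_spanb S : pred E)}.

HB.instance Definition _ (S : set E) := SubType.on (sub_span S).
HB.instance Definition _ (S : set E) := Choice.on (sub_span S).
HB.instance Definition _ (S : set E) := [SubChoice_isSubLmodule of sub_span S by <:].

Lemma sub_span_val_linear (S : set E) : linear (val : sub_span S -> E).
Proof. by []. Qed.

Lemma sub_span_valP (S : set E) (x : sub_span S) : lin_span S (val x).
Proof. by case: x => u /= /asboolP. Qed.

Lemma sub_span_surj (S : set E) u : lin_span S u -> exists x : sub_span S, val x = u.
Proof. by move=> Su; exists (exist _ u (asboolT Su)). Qed.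

End SubspaceType.

Section Transport.
Context {R : realType} (V : VOA R).
Local Notation C := R[i].
Local Notation YV := (@voa_Y R V).
Local Notation vac := (voa_vac V).

Lemma lin_fsum (E1 E2 : lmodType C) (f : E1 -> E2) (N : nat) (F : nat -> E1) :
  linear f -> (forall i, (N <= i)%N -> F i = 0) ->
  f (\sum_(i \in [set: nat]) F i) = \sum_(i \in [set: nat]) f (F i).
Proof.
move=> fL F0; rewrite (fsum_nat F0) (lin_sum fL) (fsum_nat (N := N)) // => i /F0 ->.
exact: lin0 fL.
Qed.

(** As a linear map that intertwines the modes carries each side of the Jacobi
    identity to the corresponding side, the identity descends along surjections
    and is reflected by injections. *)
Definition jacobi_lhs (E : lmodType C) (Y : V -> int -> E -> E) a b u (l m n : int) : E :=
  \sum_(i \in [set: nat]) ((-1) ^+ i * binz l i) *: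
      Y a (l + m - i%:Z) (Y b (n + i%:Z) u)
  - \sum_(i \in [set: nat]) ((-1) ^ l * (-1) ^+ i * binz l i) *:
      Y b (l + n - i%:Z) (Y a (m + i%:Z) u).

Definition jacobi_rhs (E : lmodType C) (Y : V -> int -> E -> E) a b u (l m n : int) : E :=
  \sum_(i \in [set: nat]) binz m i *: Y (YV a (l + i%:Z) b) (m + n - i%:Z) u.

Variables (E1 E2 : lmodType C) (Y1 : V -> int -> E1 -> E1) (Y2 : V -> int -> E2 -> E2).
Variable f : E1 -> E2.
Hypotheses (fL : linear f) (Y1bil : bilinear_modes Y1) (Y1tr : truncated Y1).
Hypothesis fY : forall a n u, f (Y1 a n u) = Y2 a n (f u).

Lemma jacobi_lhs_morph a b u l m n :
  f (jacobi_lhs Y1 a b u l m n) = jacobi_lhs Y2 a b (f u) l m n.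
Proof.
have [N1 h1] := vanish_from_ex Y1tr b u n.
have [N2 h2] := vanish_from_ex Y1tr a u m.
rewrite /jacobi_lhs (linB fL); congr (_ - _).
  rewrite (lin_fsum (N := N1) fL) => [|i Ni].
    by apply: eq_fsbigr => i _; rewrite (linZ fL) !fY.
  by rewrite (h1 N1) ?(lin0 (Ylinr Y1bil _ _)) ?scaler0 //; lia.
rewrite (lin_fsum (N := N2) fL) => [|i Ni].
  by apply: eq_fsbigr => i _; rewrite (linZ fL) !fY.
by rewrite (h2 N2) ?(lin0 (Ylinr Y1bil _ _)) ?scaler0 //; lia.
Qed.

Lemma jacobi_rhs_morph a b u l m n :
  f (jacobi_rhs Y1 a b u l m n) = jacobi_rhs Y2 a b (f u) l m n.
Proof.
have [N h] := vanish_from_ex (@voa_truncated R V) a b l.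
rewrite /jacobi_rhs (lin_fsum (N := N) fL) => [|i Ni].
  by apply: eq_fsbigr => i _; rewrite (linZ fL) !fY.
by rewrite (h N) ?(lin0 (Ylinl Y1bil _ _)) ?scaler0 //; lia.
Qed.

End Transport.

Definition submodule (R : realType) (V : VOA R) (M : weak_module V) (N : set M) :=
  subspace N /\ forall a n u, N u -> N (wmod_Y a n u).

Section SubQuotient.
Context {R : realType} (V : VOA R) (M : weak_module V) (N : set M).
Local Notation C := R[i].
Local Notation YV := (@voa_Y R V).
Local Notation Y := (@wmod_Y R V M).
Hypothesis Nsub : submodule N.

Let sN : subspace N := proj1 Nsub.
Let NK : lin_span N = N := lin_spanK sN.

Fact sub_mode_subproof a n (x : sub_span N) : Y a n (val x) \in (lin_spanb N : pred M).
Proof.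
apply/asboolP; have := sub_span_valP x; rewrite NK; exact: (proj2 Nsub).
Qed.

Definition sub_mode (a : V) (n : int) (x : sub_span N) : sub_span N :=
  exist _ (Y a n (val x)) (sub_mode_subproof a n x).

Lemma sub_mode_bilinear : bilinear_modes sub_mode.
Proof.
split=> [n u c a b|a n c u v]; apply: val_inj => /=.
  exact: MYlinl.
exact: MYlinr.
Qed.

Lemma sub_mode_truncated : truncated sub_mode.
Proof.
move=> a u; have [n0 h] := wmod_truncated a (val u); exists n0 => n n0n.
by apply: val_inj; exact: h.
Qed.

Lemma sub_mode_vacuum : vacuum_identity sub_mode (voa_vac V).
Proof. by move=> n u; apply: val_inj; rewrite /= wmod_vacuum; case: ifP. Qed.

Lemma sub_mode_jacobi : jacobi YV sub_mode.
Proof.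
move=> a b u l m n; apply: val_inj.
have vY c j x : val (sub_mode c j x) = Y c j (val x) by [].
have L := jacobi_lhs_morph (@sub_span_val_linear _ _ N) sub_mode_bilinear sub_mode_truncated vY.
have Rh := jacobi_rhs_morph (@sub_span_val_linear _ _ N) sub_mode_bilinear vY.
apply: etrans (L a b u l m n) _; apply: etrans (esym (Rh a b u l m n)).
exact: wmod_jacobi.
Qed.

Definition sub_module : weak_module V :=
  MkWeakModule sub_mode_bilinear sub_mode_truncated sub_mode_vacuum sub_mode_jacobi.

Local Notation Q := (quot_span N).
Local Notation proj := (quot_proj N).

Definition quot_mode (a : V) (n : int) (x : Q) : Q := proj (Y a n (repr x)).

Lemma quot_mode_proj a n u : proj (Y a n u) = quot_mode a n (proj u).
Proof.
apply/quot_projP; rewrite -(linB (MYlinr a n)) NK; apply: (proj2 Nsub).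
have : lin_span N (u - repr (proj u)) by apply/quot_projP; rewrite quot_reprK.
by rewrite NK.
Qed.

Lemma quot_proj_linear : linear proj.
Proof. by move=> c a b; rewrite quot_projD quot_projZ. Qed.

Lemma quot_mode_bilinear : bilinear_modes quot_mode.
Proof.
split=> [n x c a b|a n c x y].
  rewrite -[x]quot_reprK -!quot_mode_proj -quot_proj_linear; congr proj.
  exact: MYlinl.
rewrite -[x]quot_reprK -[y]quot_reprK -quot_proj_linear -!quot_mode_proj.
by rewrite -quot_proj_linear; congr proj; exact: MYlinr.
Qed.

Lemma quot_mode_truncated : truncated quot_mode.
Proof.
move=> a x; have [n0 h] := wmod_truncated a (repr x); exists n0 => n n0n.
by rewrite /quot_mode h // (lin0 quot_proj_linear).
Qed.

Lemma quot_mode_vacuum : vacuum_identity quot_mode (voa_vac V).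
Proof.
move=> n x; rewrite /quot_mode wmod_vacuum; case: ifP => _; first exact: quot_reprK.
exact: lin0 quot_proj_linear.
Qed.

Lemma quot_mode_jacobi : jacobi YV quot_mode.
Proof.
move=> a b x l m n; rewrite -[x]quot_reprK.
have L := jacobi_lhs_morph quot_proj_linear (@wmod_bilinear R V M)
  (@wmod_truncated R V M) quot_mode_proj.
have Rh := jacobi_rhs_morph quot_proj_linear (@wmod_bilinear R V M) quot_mode_proj.
apply: etrans (esym (L a b (repr x) l m n)) _.
apply: etrans (Rh a b (repr x) l m n); congr proj; exact: wmod_jacobi.
Qed.

Definition quot_module : weak_module V :=
  MkWeakModule quot_mode_bilinear quot_mode_truncated quot_mode_vacuum
    quot_mode_jacobi.

End SubQuotient.

(** * Irreducible quotients of lowest weight modules *)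

Section GradedWeakModule.
Context {R : realType} (V : VOA R) (M : weak_module V) (lambda : R[i]).
Local Notation C := R[i].
Local Notation Y := (@wmod_Y R V M).
Local Notation L0 := (vir M 0).
Local Notation level := (fun n : nat => L0_eigenspace M (lambda + n%:R)).
Implicit Types (a : V) (u v : M).

Lemma level_subspace n : subspace (level n).
Proof. exact: L0_eigenspace_subspace. Qed.

Lemma addn_inj (c : C) (m n : nat) : c + m%:R = c + n%:R -> m = n.
Proof. by move=> /addrI/eqP; rewrite eqr_nat => /eqP. Qed.

Lemma level_independent : independent level.
Proof.
apply: (@independentS _ _ _ _ (fun n => torsion L0 [set lambda + n%:R])) => [n|].
  move=> u /(@L0_eigen_gen R V M); exact: gen_eigenspace_torsion.
apply: torsion_independent; first exact: L0_linear.
by move=> i j c -> /addn_inj.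
Qed.

(** Such an eigenvector is annihilated by [L(0) - c] and by a polynomial in L(0)
    whose roots are of the form [lambda + n]. *)
Lemma level_absent (c : C) u : sum_space level = setT ->
  (forall n : nat, c <> lambda + n%:R) -> L0_eigenspace M c u -> u = 0.
Proof.
move=> gM cn /(@L0_eigen_gen R V M)/gen_eigenspace_torsion uc.
pose X := [set lambda + n%:R | n in [set: nat]].
apply: (torsion_disjoint (@L0_linear R V M) (X := [set c]) (Y := X)) => //.
  by move=> d -> [n _ /esym]; exact: cn.
have : sum_space level u by rewrite gM.
apply: sum_space_min; first exact: torsion_subspace (@L0_linear R V M) _.
move=> n v /(@L0_eigen_gen R V M)/gen_eigenspace_torsion; apply: torsionS => d ->.
by exists n.
Qed.

Lemma int_shift (k j : int) (n : nat) :
  lambda + n%:R + (k - j - 1)%:~R = lambda + (k + n%:Z - j - 1)%:~R :> C.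
Proof. by rewrite -addrA; congr (_ + _); rewrite pmulrn -intrD; congr (_%:~R); lia. Qed.

Lemma neg_shift (j m : nat) : lambda + (Negz j)%:~R <> lambda + m%:R :> C.
Proof.
move=> /addrI/eqP; rewrite pmulrn eqr_int => /eqP; lia.
Qed.

(** The L(0)-eigenspaces for [lambda + n] are stable under the modes as soon as
    no eigenvalue [lambda - j] occurs, so they fill every cyclic module generated
    by an eigenvector for [lambda]. *)
Lemma cyclic_graded u : L0_eigenspace M lambda u ->
  (forall N : set M, submodule N -> N u -> N = setT) ->
  (forall j v, L0_eigenspace M (lambda + (Negz j)%:~R) v -> v = 0) ->
  sum_space level = setT.
Proof.
move=> uL cyc low; have sS := sum_space_subspace level_subspace.
apply: cyc; last first.
  have u0 : level 0%N u by rewrite /= addr0.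
  exact: (@sum_space_incl _ _ _ level 0%N level_subspace u u0).
split=> // a n v Sv; move: a; apply: wt_ind.
  exact: preimage_subspace (MYlinl n v) sS.
move=> k a ak /=; move: v Sv; apply: sum_space_min.
  exact: preimage_subspace (MYlinr a n) sS.
move=> m v /(L0_mode n ak); rewrite int_shift /=.
case: (k + m%:Z - n - 1) => j vj.
  exact: (@sum_space_incl _ _ _ level j level_subspace).
by rewrite (low _ _ vj); exact: subspace0.
Qed.

Hypothesis gM : direct_sum level setT.

Lemma level_shift (k : int) (a : V) : wt_space k a ->
  forall (n : int) (m : nat) u, level m u ->
  int_graded level (k + m%:Z - n - 1) (Y a n u).
Proof.
move=> ak n m u /(L0_mode n ak); rewrite int_shift.
case: (k + m%:Z - n - 1) => j /=; first by rewrite pmulrn.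
by apply: level_absent; [case: gM|exact: neg_shift].
Qed.

Definition graded_admissible : admissible_module V :=
  MkAdmissible level_subspace gM level_shift.

End GradedWeakModule.

Section IrreducibleQuotient.
Context {R : realType} (V : VOA R).
Local Notation C := R[i].

Lemma submodule0 (M : weak_module V) : submodule [set (0 : M)].
Proof.
split=> [|a n u ->]; last exact: MY0r.
by split=> [//|u v -> ->|c u ->]; rewrite ?addr0 ?scaler0.
Qed.

(** Zorn's lemma. The empty set is admitted among the candidates only because it
    is the union of the empty chain. *)
Lemma maximal_submodule (M : weak_module V) (u : M) : u <> 0 ->
  exists N : set M, [/\ submodule N, ~ N u
    & forall N', submodule N' -> N `<=` N' -> ~ N' u -> N' `<=` N].
Proof.
move=> u0; pose P := [set N : set M | (N = set0 \/ submodule N) /\ ~ N u].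
have [F FP tot|N [[N0 Nu] Nmax]] := @Zorn_bigcup _ P.
  split; last by case=> N /FP[_ Nu] /Nu.
  have [F0|/existsNP[N0 /not_implyP[FN0 sN0]]] :=
      pselect (forall N, F N -> N = set0).
    by left; apply/seteqP; split=> // v [N /F0 -> ].
  have smod N v : F N -> N v -> submodule N by move=> /FP[[-> //|//]].
  have common v w : (\bigcup_(X in F) X) v -> (\bigcup_(X in F) X) w ->
      exists N, [/\ F N, N v & N w].
    move=> [N1 F1 N1v] [N2 F2 N2w]; have [N12|N21] := tot _ _ F1 F2.
      by exists N2; split=> //; exact: N12.
    by exists N1; split=> //; exact: N21.
  right; split; last first.
    move=> a n v [N FN Nv]; exists N => //; exact: (smod N v FN Nv).2.
  split=> [|v w Fv Fw|c v [N FN Nv]].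
  - have [_ [[//|[s0 _]] _]] := (I, FP _ FN0).
    by exists N0 => //; exact: subspace0.
  - have [N [FN Nv Nw]] := common v w Fv Fw; exists N => //.
    exact: subspaceD (smod N v FN Nv).1 Nv Nw.
  - by exists N => //; exact: subspaceZ (smod N v FN Nv).1 Nv.
have sN : submodule N.
  case: N0 => // N0; case: (Nmax [set 0]); last by split=> //; right; exact: submodule0.
  by rewrite N0; split=> // /(_ 0 erefl).
exists N; split=> // N' sN' NN' N'u; apply: contrapT => nN'.
by apply: (Nmax N'); split=> //; right.
Qed.

(** In the module generated by [u], a submodule that contains [u] is everything.
    Hence its quotient by a submodule [N] maximal among those that do not contain
    [u] is irreducible: the preimage of a submodule of the quotient contains [u] or
    is [N]. *)
Lemma irreducible_lowest_weight (M : weak_module V) (lambda : C) (u : M) :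
  L0_eigenspace M lambda u -> u <> 0 ->
  (forall j v, L0_eigenspace M (lambda + (Negz j)%:~R) v -> v = 0) ->
  lowest_weights V lambda.
Proof.
move=> uL u0 low.
pose W := [set v | forall N : set M, submodule N -> N u -> N v].
have sW : submodule W.
  split; last by move=> a n v Wv N sN Nu; apply: sN.2; exact: Wv.
  split=> [N [sN _] _|v w Wv Ww N sN Nu|c v Wv N sN Nu].
  - exact: subspace0.
  - by apply: (subspaceD sN.1); [exact: Wv|exact: Ww].
  - by apply: (subspaceZ c sN.1); exact: Wv.
pose X := sub_module sW.
have [x0 x0u] : exists x : X, val x = u.
  by apply: sub_span_surj; apply: lin_span_incl.
have xW (x : X) : W (val x).
  by have := sub_span_valP x; rewrite (lin_spanK sW.1).
have cyc (N : set X) : submodule N -> N x0 -> N = setT.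
  move=> sN Nx0; apply/seteqP; split=> // x _.
  have : [set v | exists2 y : X, N y & val y = v] (val x).
    apply: xW; last by exists x0.
    split; last by move=> a n _ [y Ny <-]; exists (wmod_Y a n y) => //; exact: sN.2.
    split=> [|_ _ [y Ny <-] [z Nz <-]|c _ [y Ny <-]].
    - by exists 0 => //; exact: subspace0 sN.1.
    - by exists (y + z) => //; exact: subspaceD sN.1 Ny Nz.
    - by exists (c *: y) => //; exact: subspaceZ sN.1 Ny.
  by move=> [y Ny /val_inj <-].
have XL c (x : X) : L0_eigenspace X c x -> L0_eigenspace M c (val x).
  by move=> /(congr1 val).
have x0L : L0_eigenspace X lambda x0.
  by apply: val_inj; rewrite /= x0u; exact: uL.
have gX : sum_space (fun n : nat => L0_eigenspace X (lambda + n%:R)) = setT.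
  apply: (cyclic_graded x0L) => //.
  by move=> j x /XL/low x_0; apply: val_inj.
have x0n0 : x0 <> 0 by move=> x00; apply: u0; rewrite -x0u x00.
have [N [sN Nx0 Nmax]] := maximal_submodule x0n0.
pose Q := quot_module sN; pose p : X -> Q := quot_proj N.
have pL : linear p by exact: quot_proj_linear.
have pY a n x : p (wmod_Y a n x) = wmod_Y a n (p x) by exact: quot_mode_proj.
have pL0 x : vir Q 0 (p x) = p (vir X 0 x) by rewrite /vir pY.
have pE c x : L0_eigenspace X c x -> L0_eigenspace Q c (p x).
  move=> xc; rewrite /L0_eigenspace /eigenspace_of -[_ (p x)]/(vir Q 0 (p x) = _).
  by rewrite pL0 -(linZ pL) -xc.
have psurj (y : Q) : exists x, p x = y by exists (repr y); exact: quot_reprK.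
have p0 x : p x = 0 <-> N x.
  rewrite -(lin0 pL) /p quot_projP subr0 (lin_spanK sN.1) //.
have gQ : direct_sum (fun n : nat => L0_eigenspace Q (lambda + n%:R)) setT.
  split; first exact: level_independent.
  apply/seteqP; split=> // y _; have [x <-] := psurj y.
  have xS : sum_space (fun n : nat => L0_eigenspace X (lambda + n%:R)) x by rewrite gX.
  have sG := @level_subspace R V Q lambda.
  apply: sum_space_min (preimage_subspace pL (sum_space_subspace sG)) _ _ xS.
  by move=> n z zn; apply: (@sum_space_incl _ _ _ _ n sG); exact: pE.
exists (graded_admissible gQ); split; last first.
  split=> //= L00; have : [set (0 : Q)] (p x0).
    rewrite -L00; exact: pE.
  by move=> /p0.
split.
  move=> T0; have : [set (0 : Q)] (p x0) by rewrite -T0.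
  by move=> /p0.
move=> P [sP PY _]; pose B := [set x | P (p x)].
have sB : submodule B.
  split; first exact: preimage_subspace.
  by move=> a n x Bx; rewrite /B /= pY; exact: PY.
have NB : N `<=` B by move=> x /p0 px; rewrite /B /= px; exact: subspace0.
have [Bx0|nBx0] := pselect (B x0).
  right; apply/seteqP; split=> // y _; have [x <-] := psurj y.
  by have : B x by rewrite (cyc B sB Bx0).
left; apply/seteqP; split=> [y Py|y ->]; last exact: subspace0.
have [x xy] := psurj y; rewrite /= -xy; apply/p0/(Nmax B) => //.
by rewrite /B /= xy.
Qed.

End IrreducibleQuotient.

(** * Minimal eigenvalues and the decomposition *)

Section OccurringEigenvalues.
Context {R : realType} (V : VOA R) (M : admissible_module V).
Local Notation C := R[i].
Local Notation L0 := (vir M 0).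
Local Notation gen := (gen_L0_eigenspace M).
Implicit Types (c d : C) (u v : M).

Definition occurs c := exists u : M, L0_eigenspace M c u /\ u <> 0.

Lemma gen_L0_absent c u : ~ occurs c -> gen c u -> u = 0.
Proof.
move=> nc uc; apply: contrapT => /(gen_L0_eigenvector uc)[v vc].
by apply: nc; exists v.
Qed.

(** Minimality in the coset of [c] modulo the integers: [Negz j] runs through the
    negative integers. *)
Definition minimal_value c := occurs c /\ forall j, ~ occurs (c + (Negz j)%:~R).

Lemma minimal_value_lowest_weight c : minimal_value c -> lowest_weights V c.
Proof.
move=> [[u [uc u0]] cmin]; apply: (irreducible_lowest_weight uc u0) => j v vj.
by apply: contrapT => v0; apply: (cmin j); exists v.
Qed.

Lemma minimal_value_unique c d (m n : nat) : minimal_value c -> minimal_value d ->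
  c + m%:R = d + n%:R -> c = d.
Proof.
wlog mn : c d m n / (m <= n)%N => [h cm dm e|cm dm e].
  have [mn|/ltnW nm] := leqP m n; first exact: h mn cm dm e.
  by symmetry; exact: (h d c n m nm dm cm (esym e)).
have cE : c = d + (n - m)%N%:R by rewrite natrB // addrA -e addrK.
case E : (n - m)%N cE => [|j] cE; first by rewrite cE addr0.
case: cm => _ /(_ j) []; case: dm => dm _.
by rewrite cE -addrA NegzE mulrNz pmulrn subrr addr0.
Qed.

Variable r : seq (C * V).
Hypothesis r_unit : lin_span (@zhu_generators R V) (voa_vac V - \sum_(p <- r) p.2).
Hypothesis r_scalar : forall p, p \in r ->
  lin_span (@zhu_generators R V) (zhu_star (voa_omega V) p.2 - p.1 *: p.2).

Lemma occurs_value c : occurs c -> L0_values r c.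
Proof.
move=> [u [uc u0]]; apply: contrapT => nc; apply: u0.
apply: (torsion_disjoint (@L0_linear R V M) (X := [set c]) (Y := L0_values r)).
- by move=> d -> /nc.
- exact/gen_eigenspace_torsion/L0_eigen_gen.
- exact: amod_torsion.
Qed.

(** Every eigenvalue is of the form [p.1 + m] with [m] a natural number, so for each
    of the finitely many [p] the descent from [c] by integers is bounded. *)
Lemma minimal_value_exists c : occurs c ->
  exists d (n : nat), minimal_value d /\ c = d + n%:R.
Proof.
move=> oc.
have bound p : exists B : nat, forall j m : nat, c - j%:R = p + m%:R -> (j <= B)%N.
  have [[j0 [m0 e0]]|h] := pselect (exists j0 m0 : nat, c - j0%:R = p + m0%:R).
    exists (j0 + m0)%N => j m e.
    suff -> : (j0 + m0 = j + m)%N by exact: leq_addr.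
    have shift (a b : nat) : c - a%:R = p + b%:R -> c = p + (a + b)%N%:R.
      by move=> /eqP; rewrite subr_eq => /eqP ->; rewrite natrD [a%:R + _]addrC addrA.
    by apply: (@addn_inj R p); rewrite -(shift _ _ e) -(shift _ _ e0).
  by exists 0%N => j m e; case: h; exists j, m.
have [B BP] := choice (fun p : C * V => bound p.1).
pose P (j : nat) := `[< occurs (c - j%:R) >].
have P0 : exists j, P j by exists 0%N; apply/asboolP; rewrite subr0.
have Pb j : P j -> (j <= \max_(p <- r) B p)%N.
  move=> /asboolP /occurs_value[p [m [pr e]]].
  apply: leq_trans (BP p j m e) _.
  by apply: (@leq_bigmax_seq _ r xpredT B).
case: (ex_maxnP P0 Pb) => j /asboolP oj jmax.
exists (c - j%:R), j; split; last by rewrite subrK.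
split=> // i oi; have : P (j + i.+1)%N.
  apply/asboolP; move: oi; congr occurs.
  by rewrite NegzE mulrNz -pmulrn natrD opprD addrA.
by move=> /jmax; lia.
Qed.

(** By [minimal_value_unique], each [p] in [r] contributes at most one minimal
    eigenvalue of the form [p.1 + m]. *)
Lemma minimal_values_finite :
  exists2 l : seq C, uniq l & forall c, c \in l <-> minimal_value c.
Proof.
pose S (p : C * V) := [set c | minimal_value c /\ exists m : nat, c = p.1 + m%:R].
pose g p := xget 0 (S p).
have : finite_set [set c | minimal_value c].
  apply: sub_finite_set (finite_image g (finite_seq r)) => c mc.
  have [p [m [pr cE]]] := occurs_value mc.1.
  have [gm [m' gE]] : S p (g p) by apply: xgetPex; exists c; split=> //; exists m.
  exists p => //; apply: (@minimal_value_unique _ _ m m' gm mc).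
  by rewrite gE cE addrAC.
move=> /finite_seqP[l lE]; exists (undup l); first exact: undup_uniq.
move=> c; rewrite mem_undup; have -> : minimal_value c = [set c | minimal_value c] c by [].
by rewrite lE.
Qed.

Lemma degree_op_gen c u : gen c u -> gen c (degree_op u).
Proof.
move=> /gen_eigenspace_torsion uc; apply: torsion_gen_eigenspace.
apply: (torsion_stable (D := @degree_op R V M)) uc; first exact: degree_op_linear.
move=> v; apply/eqP; rewrite -subr_eq0; apply/eqP.
exact: etrans (degree_op_mode (0 + 1) v (omega_wt2 V)) (scale0r _).
Qed.

End OccurringEigenvalues.

Theorem theorem3p1 (R : realType) (V : VOA R)
    (hA : semisimple (zhu_mul V)) (M : admissible_module V) :
  exists (s : nat) (lambda : 'I_s -> R[i]),
    [/\ forall i, lowest_weights V (lambda i),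
        forall i, independent
          (fun n : nat => gen_L0_eigenspace M (lambda i + n%:R)),
        direct_sum
          (fun i : 'I_s => sum_space
             (fun n : nat => gen_L0_eigenspace M (lambda i + n%:R))) [set: M]
      & forall i, admissible_submodule M
          (sum_space (fun n : nat => gen_L0_eigenspace M (lambda i + n%:R)))].
Proof.
have [r [r_unit r_scalar]] := semisimple_unit hA.
have [l ul lP] := minimal_values_finite M r_unit r_scalar.
pose lambda (i : 'I_(size l)) := nth 0 l i.
have lmin i : minimal_value M (lambda i) by apply/lP/mem_nth.
have linj : injective lambda.
  by move=> i j /eqP; rewrite nth_uniq // => /eqP ij; apply: val_inj.
have TL := @L0_linear R V M.
pose G i (n : nat) := gen_L0_eigenspace M (lambda i + n%:R).
have sG i n : subspace (G i n) by exact: gen_L0_subspace.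
have sF i : subspace (sum_space (G i)) by exact: sum_space_subspace.
have sS : subspace (sum_space (fun i => sum_space (G i))).
  exact: sum_space_subspace.
exists (size l), lambda; split=> [i|i||i].
- exact: minimal_value_lowest_weight.
- apply: (@independentS _ _ _ _ (fun n => torsion (vir M 0) [set lambda i + n%:R])).
    by move=> n; exact: gen_eigenspace_torsion.
  by apply: torsion_independent => // m n c -> /addn_inj.
- split.
    apply: (@independentS _ _ _ _
      (fun i => torsion (vir M 0) [set lambda i + n%:R | n in [set: nat]])).
      move=> i; apply: sum_space_min; first exact: torsion_subspace.
      move=> n u /gen_eigenspace_torsion; apply: torsionS => c ->; by exists n.
    apply: torsion_independent => // i j _ [m _ <-] [n _ /esym e].
    exact/linj/(minimal_value_unique (lmin i) (lmin j) e).
  apply/seteqP; split=> // u _.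
  apply: (torsion_min TL sS _ (amod_torsion r_unit r_scalar u)) => c _ v vc.
  have [oc|/gen_L0_absent/(_ vc) ->] := pselect (occurs M c); last exact: subspace0.
  have [d [n [/lP/(nthP 0)[i il <-] cE]]] := minimal_value_exists r_unit r_scalar oc.
  rewrite cE in vc.
  apply: (@sum_space_incl _ _ _ (fun i => sum_space (G i)) (Ordinal il)) => //.
  exact: (@sum_space_incl _ _ _ (G (Ordinal il)) n).
- split=> [|a n u Fu|u]; first exact: sF.
    move: a; apply: wt_ind; first exact: preimage_subspace (MYlinl n u) (sF i).
    move=> k a ak; move: u Fu; apply: sum_space_min.
      exact: preimage_subspace (MYlinr a n) (sF i).
    move=> m u /(gen_L0_mode n ak); rewrite int_shift.
    case: (k + m%:Z - n - 1) => j uj; first exact: (@sum_space_incl _ _ _ (G i) j).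
    have [_ nj] := lmin i; rewrite /= (gen_L0_absent (nj j) uj).
    exact: subspace0 (sF i).
  move: u; apply: sum_space_min.
    exact: preimage_subspace (@degree_op_linear R V M) (sF i).
  move=> n u un; apply: (@sum_space_incl _ _ _ (G i) n) => //.
  exact: degree_op_gen.
Qed.
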